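(* Let $N\ge4$ be an integer and set $$\gamma_N=\frac{(N-2)(N-6)}{12},\qquad \gamma_1=\dots=\gamma_{N-1}=1,\qquad \zeta=e^{2\pi\mathbf{i}/(N-1)}.$$ Consider the configuration $z_k^*=\zeta^k$ for $1\le k\le N-1$ and $z_N^*=0$ (with $\mathbb{C}$ identified with $\mathbb{R}^2$), with intensities $\gamma_1,\dots,\gamma_N$. Then this configuration satisfies both the zero-strain hypothesis (A) and the linear stability hypothesis (B) described in the context. In the special case $N=6$, where $\gamma_6=0$, this is understood in the sense that the configuration consists only of the $5$ exterior vortices $z_1^*,\dots,z_5^*$ with intensities $1$.
   Context: Let $n$ be the number of vortices ($n=N$ if $N\neq6$, $n=5$ if $N=6$), with positions $Z^*=(z_1^*,\dots,z_n^* )$ and nonzero intensities $\gamma_1,\dots,\gamma_n$. Notation: $x^\perp=(-x_2,x_1)$; $K(x)=\frac{x^\perp}{2\pi|x|^2}$ for $x\in\mathbb{R}^2\setminus\{0\}$; $J_K(x)\in\mathcal{M}_2(\mathbb{R})$ is the Jacobian matrix of $K$ at $x$. Write $Z=(z_1,\dots,z_n)=(x_1,y_1,\dots,x_n,y_n)\in\mathbb{R}^{2n}$. Point-vortex system. $t\mapsto Z^*(t)=(z_1^*(t),\dots,z_n^*(t))$ denotes the solution of $\frac{d}{dt}z_i(t)=\sum_{j\ne i}\gamma_jK(z_i(t)-z_j(t))$ with $Z^*(0)=Z^*$. Hypothesis (A) (zero strain): for all $t\ge0$ and all $i\in\{1,\dots,n\}$, $\sum_{j\ne i}\gamma_jJ_K(z_i^*(t)-z_j^*(t))=0$.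 Hypothesis (B) (linearly stable relative equilibrium): Let $H(Z)=\frac12\sum_{i\ne j}\gamma_i\gamma_j\ln|z_i-z_j|$ (sum over ordered pairs), let $J$ be the $2n\times2n$ block-diagonal matrix with $n$ diagonal blocks $\begin{pmatrix}0&-1\\1&0\end{pmatrix}$, and let $\Gamma=\mathrm{diag}(\gamma_1,\gamma_1,\dots,\gamma_n,\gamma_n)$. One requires: $\sum_{i\ne j}\gamma_i\gamma_j\ne0$; there is $\nu\in\mathbb{R}$ with $\nabla H(Z^* )+\nu\Gamma Z^*=0$ (i.e. $Z^*$ is an equilibrium of the rotating-frame system $\Gamma\frac{d}{dt}Z=J(\nabla H(Z)+\nu\Gamma Z)$; necessarily $\nu=-\frac{\sum_{i\ne j}\gamma_i\gamma_j}{2\sum_i\gamma_i|z_i^*|^2}$); and, setting $S=\Gamma^{-1}J\,\mathrm{D}^2H(Z^* )+\nu J$, $V=\mathrm{span}\{Z^*,JZ^*\}$ and $V^\perp=\{Y\in\mathbb{R}^{2n}:\ {}^tY\Gamma Z=0\ \ \forall Z\in V\}$ (it is known that then $V\oplus V^\perp=\mathbb{R}^{2n}$ and both are $S$-invariant), there is a basis of $V^\perp$ in which $S|_{V^\perp}$ is block diagonal with $2\times2$ blocks of the form $\begin{pmatrix}0&b\\-b&0\end{pmatrix}$, $b\in\mathbb{R}$. (Here $H$ carries no factor $\frac{1}{2\pi}$; this only amounts to a rescaling of time.) *)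

(* Defs.v *)
From HB Require Import structures.
From mathcomp Require Import all_boot all_order all_algebra.
From mathcomp Require Import all_classical all_reals all_analysis.
From mathcomp Require Import complex.

Set Implicit Arguments.
Unset Strict Implicit.
Unset Printing Implicit Defensive.

Import Order.TTheory GRing.Theory Num.Theory.
Import numFieldNormedType.Exports.

Local Open Scope classical_set_scope.
Local Open Scope ring_scope.

(* Points of the plane are row vectors 'rV[R]_2. The library norm `|x| on
   matrices is the sup norm, hence the explicit Euclidean norm. *)
Definition enorm (R : realType) (x : 'rV[R]_2) : R :=
  Num.sqrt (x 0 0 ^+ 2 + x 0 1 ^+ 2).

Definition perp (R : realType) (x : 'rV[R]_2) : 'rV[R]_2 :=
  \row_(j < 2) if j == 0 then - x 0 1 else x 0 0.

(* Only meaningful for x != 0. *)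
Definition K (R : realType) (x : 'rV[R]_2) : 'rV[R]_2 :=
  (2 * pi * enorm x ^+ 2)^-1 *: perp x.

(* [jacobian] acts on row vectors by right multiplication; transposing gives
   the usual matrix, with entry (i, j) equal to d K_i / d x_j. *)
Definition JK (R : realType) (x : 'rV[R]_2) : 'M[R]_2 := (jacobian (@K R) x)^T.

(* Solutions on [0, +oo[: the equation is required for t > 0, together with
   continuity at 0, so that Z at negative times plays no role. *)
Definition pv_solution (R : realType) (n : nat) (gam : 'I_n -> R)
    (z : 'I_n -> 'rV[R]_2) (Z : R -> 'I_n -> 'rV[R]_2) : Prop :=
  [/\ forall i, Z 0 i = z i,
      forall t : R, 0 <= t -> forall i j, i != j -> Z t i != Z t j,
      forall i, {within `[0, +oo[, continuous (fun t : R => Z t i)} &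
      forall t : R, 0 < t -> forall i,
        is_derive t (1 : R) (fun s : R => Z s i)
          (\sum_(j < n | j != i) gam j *: K (Z t i - Z t j))].

Definition zero_strain (R : realType) (n : nat) (gam : 'I_n -> R)
    (z : 'I_n -> 'rV[R]_2) : Prop :=
  (exists Z, pv_solution gam z Z) /\
  forall Z, pv_solution gam z Z ->
    forall t : R, 0 <= t -> forall i,
      \sum_(j < n | j != i) gam j *: JK (Z t i - Z t j) = 0.

(* R^{2n} is the space of columns of height \sum_(i < n) 2, whose i-th 2-block
   [submxcol Z i] is the position of the i-th vortex. *)
Definition config (R : realType) (n : nat) (z : 'I_n -> 'rV[R]_2)
  : 'cV[R]_(\sum_(i < n) 2) := \mxcol_(i < n) (z i)^T.

Definition position (R : realType) (n : nat) (Z : 'cV[R]_(\sum_(i < n) 2))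
  (i : 'I_n) : 'rV[R]_2 := (submxcol Z i)^T.

Definition antisym2 (R : realType) (b : R) : 'M[R]_2 :=
  \matrix_(i < 2, j < 2)
    if (i == 0) && (j == 1) then b
    else if (i == 1) && (j == 0) then - b else 0.

Definition Jmx (R : realType) (n : nat) : 'M[R]_(\sum_(i < n) 2) :=
  \mxdiag_(i < n) antisym2 (-1).

Definition Gammamx (R : realType) (n : nat) (gam : 'I_n -> R)
  : 'M[R]_(\sum_(i < n) 2) := \mxdiag_(i < n) (gam i)%:M.

Definition H (R : realType) (n : nat) (gam : 'I_n -> R)
    (Z : 'cV[R]_(\sum_(i < n) 2)) : R :=
  2^-1 * \sum_(i < n) \sum_(j < n | j != i)
    gam i * gam j * ln (enorm (position Z i - position Z j)).

Definition gradient (R : realType) (d : nat) (f : 'cV[R]_d -> R)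
  (Z : 'cV[R]_d) : 'cV[R]_d := \col_(p < d) 'D_(delta_mx p 0) f Z.

Definition hessian (R : realType) (d : nat) (f : 'cV[R]_d -> R)
    (Z : 'cV[R]_d) : 'M[R]_d :=
  \matrix_(p < d, q < d)
    'D_(delta_mx p 0) (fun W => 'D_(delta_mx q 0) f W) Z.

Definition is_basis (R : realType) (d k : nat) (W : set 'cV[R]_d)
    (P : 'M[R]_(d, k)) : Prop :=
  [/\ forall j, W (col j P),
      row_free P^T &
      forall Y, W Y -> exists c : 'cV[R]_k, Y = P *m c].

Definition Vspace (R : realType) (n : nat) (Z : 'cV[R]_(\sum_(i < n) 2))
  : set 'cV[R]_(\sum_(i < n) 2) :=
  [set Y | exists a b : R, Y = a *: Z + b *: (Jmx R n *m Z)].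

Definition Vperp (R : realType) (n : nat) (gam : 'I_n -> R)
    (Z : 'cV[R]_(\sum_(i < n) 2)) : set 'cV[R]_(\sum_(i < n) 2) :=
  [set Y | forall X, Vspace Z X -> Y^T *m Gammamx gam *m X = 0].

Definition Smx (R : realType) (n : nat) (gam : 'I_n -> R)
    (Z : 'cV[R]_(\sum_(i < n) 2)) (nu : R) : 'M[R]_(\sum_(i < n) 2) :=
  invmx (Gammamx gam) *m Jmx R n *m hessian (H gam) Z + nu *: Jmx R n.

(* The columns of P form a basis of V^perp, and S *m P = P *m B says that B is
   the matrix of the restriction of S to V^perp in that basis. *)
Definition linearly_stable_releq (R : realType) (n : nat) (gam : 'I_n -> R)
    (z : 'I_n -> 'rV[R]_2) : Prop :=
  let Z := config z in
  \sum_(i < n) \sum_(j < n | j != i) gam i * gam j != 0 /\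
  exists nu : R,
    gradient (H gam) Z + nu *: (Gammamx gam *m Z) = 0 /\
    exists (m : nat) (b : 'I_m -> R)
           (P : 'M[R]_(\sum_(i < n) 2, \sum_(k < m) 2)),
      is_basis (Vperp gam Z) P /\
      Smx gam Z nu *m P = P *m \mxdiag_(k < m) antisym2 (b k).

(* When N = 6 the central vortex has zero intensity and is dropped. *)
Definition nvort (N : nat) : nat := if N == 6 then 5 else N.

Definition expi (R : realType) (t : R) : R[i] := Complex (cos t) (sin t).

Definition plane_of_complex (R : realType) (w : R[i]) : 'rV[R]_2 :=
  \row_(j < 2) if j == 0 then complex.Re w else complex.Im w.

(* The index i : 'I_(nvort N) stands for the vortex number i.+1; the central
   vortex is the number N, so it does not occur when N = 6. *)
Definition intensity (R : realType) (N : nat) (i : 'I_(nvort N)) : R :=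
  if (i.+1 < N)%N then 1 else (N%:R - 2) * (N%:R - 6) / 12.

Definition vortex (R : realType) (N : nat) (i : 'I_(nvort N)) : 'rV[R]_2 :=
  if (i.+1 < N)%N
  then plane_of_complex (expi (2 * pi / (N%:R - 1)) ^+ i.+1) else 0.

(* Main.v *)
(* Identify the plane with C; then conj (K z) = 1 / (2 pi i z), so zero strain
   at z_i means sum_(j != i) gamma_j / (z_i - z_j)^2 = 0. For the m-gon with a
   central vortex this follows from closed forms of the sums over l of
   zeta^(a l) / (1 - zeta^l)^2, obtained from the difference equation in a. The
   condition is invariant under rotation, the configuration rotates rigidly, and
   a Gronwall argument shows that the rigid rotation is the only solution.

   Zero strain also removes the diagonal part of the Hessian, and the linearized
   operator becomes y |-> i (conj (A y) + nu y), A_ij = gamma_j / (z_i - z_j)^2.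
   In the frame attached to each exterior vortex A acts on waves of frequency k
   with the real eigenvalue sigma_k = nu + k (m - k) / 2. A wave and its image
   span an invariant plane on which S^2 = sigma_k^2 - nu^2, which is negative
   for 0 < k < m; k = 0 is the excluded plane V. The central vortex couples only
   with k = 1 and k = m - 1; there one finds the translations, with
   S^2 = - nu^2, and the perturbations fixing the center of vorticity, with
   S^2 = gamma (m + gamma) - nu^2 = - (m^2 - 1) / 6. *)
Require Import Defs.
From mathcomp Require Import all_boot all_order all_algebra.
From mathcomp Require Import all_classical all_reals all_analysis.
From mathcomp Require Import complex.
From mathcomp Require Import ring lra zify.
Set Implicit Arguments.
Unset Strict Implicit.
Unset Printing Implicit Defensive.
Import Order.TTheory GRing.Theory Num.Theory.
Import numFieldNormedType.Exports.
Local Open Scope classical_set_scope.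
Local Open Scope ring_scope.
Local Notation Re := complex.Re.
Local Notation Im := complex.Im.
Local Notation ci := (Complex 0 1).
Local Notation "w ^~" := (conjc w) (at level 1, format "w ^~").
Local Notation "x %:C" := (real_complex _ x)
  (at level 1, format "x %:C") : ring_scope.

(** * Sums over roots of unity *)

Section RootsOfUnitySums.
Variables (F : numFieldType) (m : nat) (z : F).
Hypothesis prim_z : m.-primitive_root z.

Let m_gt0 : (0 < m)%N := prim_order_gt0 prim_z.
Let m_neq0 : (m%:R : F) != 0.
Proof. by rewrite pnatr_eq0 -lt0n. Qed.

Lemma prim_neq0 k : z ^+ k != 0.
Proof.
apply/expf_neq0/negP => /eqP z0; have := prim_expr_order prim_z.
by rewrite z0 expr0n gtn_eqF // => /esym/eqP; rewrite oner_eq0.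
Qed.

Lemma prim_expr_eq1 k : (z ^+ k == 1) = (m %| k)%N.
Proof. by rewrite -(expr0 z) (eq_prim_root_expr prim_z) mod0n. Qed.

Lemma prim_exprDm k : z ^+ (m + k) = z ^+ k.
Proof. by rewrite exprD (prim_expr_order prim_z) mul1r. Qed.

Lemma prim_expr_neq1 l : (0 < l < m)%N -> 1 - z ^+ l != 0.
Proof.
move=> /andP[l0 lm]; rewrite subr_eq0 eq_sym prim_expr_eq1.
by apply/negP => /(dvdn_leq l0); rewrite leqNgt lm.
Qed.

Lemma prim_subM_neq0 i l : (0 < l < m)%N -> z ^+ i - z ^+ i * z ^+ l != 0.
Proof.
move=> lm; have -> : z ^+ i - z ^+ i * z ^+ l = z ^+ i * (1 - z ^+ l) by ring.
by rewrite mulf_neq0 ?prim_neq0 ?prim_expr_neq1.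
Qed.

Lemma prim_expr_inj i j : (i < m)%N -> (j < m)%N -> i != j ->
  z ^+ i - z ^+ j != 0.
Proof.
by move=> im jm; rewrite subr_eq0 (eq_prim_root_expr prim_z) !modn_small.
Qed.

Lemma sum_prim a : \sum_(0 <= l < m) z ^+ (a * l) = (m * (m %| a))%:R.
Proof.
have [ma|ma] := boolP (m %| a)%N.
  rewrite (eq_big_nat _ _ (F2 := fun=> 1)); last first.
    by move=> l _; apply/eqP; rewrite prim_expr_eq1 dvdn_mulr.
  by rewrite big_const_nat iter_addr_0 subn0 muln1.
apply/eqP; rewrite muln0; have := subrX1 (z ^+ a) m.
rewrite -exprM mulnC exprM (prim_expr_order prim_z) expr1n subrr => /esym/eqP.
rewrite mulf_eq0 subr_eq0 prim_expr_eq1 (negbTE ma) /=.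
by rewrite big_mkord; under eq_bigr do rewrite -exprM.
Qed.

Lemma sum_prim_pos a :
  \sum_(1 <= l < m) z ^+ (a * l) = (m * (m %| a))%:R - 1.
Proof.
by rewrite -sum_prim [in RHS]big_ltn // muln0 expr0 [1 + _]addrC addrK.
Qed.

Lemma sum_prim_shift (V : nmodType) (G : F -> V) i :
  \sum_(0 <= j < m) G (z ^+ (i + j)) = \sum_(0 <= j < m) G (z ^+ j).
Proof.
elim: i => [//|i IHi]; rewrite -IHi.
case: m m_gt0 prim_exprDm => // m' _ zD.
rewrite big_nat_recr //= big_nat_recl //= addn0 addrC.
congr (_ + _); first by rewrite addSnnS addnC zD.
by apply: eq_bigr => j _; rewrite addSnnS.
Qed.

(** The roots other than [z ^+ i.+1] are its products with [z ^+ l], [0 < l < m]. The exponent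
    [j.+1] follows the numbering of the vortices from 1. *)
Lemma sum_prim_neq (V : nmodType) (G : F -> V) i : (i < m)%N ->
  \sum_(0 <= j < m | j != i) G (z ^+ j.+1) =
  \sum_(1 <= l < m) G (z ^+ i.+1 * z ^+ l).
Proof.
move=> im.
(* Setting the summand to zero at the omitted root makes the sum a full one, which can be
   shifted. *)
pose G' w := if w == z ^+ i.+1 then 0 else G w.
transitivity (\sum_(0 <= j < m) G' (z ^+ (1 + j))).
  rewrite big_mkcond !big_nat; apply: eq_bigr => j /andP[_ jm].
  rewrite /G' add1n; have [->|ji] := eqVneq j i; first by rewrite eqxx.
  rewrite (negbTE (_ : z ^+ j.+1 != z ^+ i.+1)) // -subr_eq0 !exprS -mulrBr.
  by rewrite mulf_neq0 // ?prim_expr_inj // -(expr1 z) prim_neq0.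
rewrite sum_prim_shift -(sum_prim_shift _ i.+1) big_ltn // addn0 {1}/G' eqxx.
rewrite add0r !big_nat; apply: eq_bigr => l lm; rewrite exprD /G'.
rewrite -subr_eq0 -[X in _ - X]mulr1 -mulrBr mulf_eq0 (negbTE (prim_neq0 _)).
by rewrite -opprB oppr_eq0 (negbTE (prim_expr_neq1 lm)).
Qed.

Definition inv1_sum a := \sum_(1 <= l < m) z ^+ (a * l) / (1 - z ^+ l).
Definition inv2_sum a := \sum_(1 <= l < m) z ^+ (a * l) / (1 - z ^+ l) ^+ 2.

(** For [w = z ^+ l], [w ^+ a.+1 / (1 - w)] equals [w ^+ a / (1 - w) - w ^+ a], so one step in [a]
    costs a geometric sum; [inv2_sumS] divides the same identity by [1 - w]. *)
Lemma inv1_sumS a : inv1_sum a.+1 = inv1_sum a + 1 - (m * (m %| a))%:R.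
Proof.
rewrite -addrA -[1 - _]opprB -sum_prim_pos -sumrB /inv1_sum !big_nat.
apply: eq_bigr => l /prim_expr_neq1 zl; rewrite mulSn exprD; field.
exact: zl.
Qed.

Lemma inv2_sumS a : inv2_sum a.+1 = inv2_sum a - inv1_sum a.
Proof.
rewrite -sumrB /inv2_sum !big_nat.
apply: eq_bigr => l /prim_expr_neq1 zl; rewrite mulSn exprD; field.
exact: zl.
Qed.

(* Replacing l by m - l turns 1/(1 - w) into 1/(1 - 1/w) = 1 - 1/(1 - w). *)
Lemma inv1_sum0 : inv1_sum 0 = (m%:R - 1) / 2.
Proof.
have E : inv1_sum 0 + inv1_sum 0 = m%:R - 1.
  rewrite {2}/inv1_sum big_nat_rev -big_split /=.
  rewrite -(natrB _ m_gt0) -[in RHS]sumr_const_nat !big_nat.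
  apply: eq_bigr => l lm; have zl := prim_expr_neq1 lm.
  have -> : (1 + m - l.+1 = m - l)%N by lia.
  have -> : z ^+ (m - l) = (z ^+ l)^-1.
    apply: (mulfI (prim_neq0 l)); rewrite -exprD subnKC; last lia.
    by rewrite (prim_expr_order prim_z) divff // prim_neq0.
  have z0 := prim_neq0 l; rewrite !mul0n expr0; field.
  by rewrite zl z0 -opprB oppr_eq0 zl.
by rewrite -E; field.
Qed.

(** Only the step from 0 to 1 subtracts [m], since [m] divides 0; every later step up to [m] adds
    1. *)
Lemma inv1_sum_pos k : (0 < k <= m)%N -> inv1_sum k = k%:R - (m%:R + 1) / 2.
Proof.
elim: k => [//|k IHk] km; rewrite inv1_sumS.
have [->|k0] := posnP k; first by rewrite inv1_sum0 dvdn0 muln1; field.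
rewrite IHk; last lia.
have /negbTE-> : ~~ (m %| k)%N by apply/negP => /(dvdn_leq k0); lia.
by rewrite -natr1 muln0; field.
Qed.

Lemma inv2_sum_rec k : (k <= m)%N ->
  inv2_sum k.+1 = inv2_sum 1 + k%:R * (m%:R - k%:R) / 2.
Proof.
elim: k => [|k IHk] km; first by rewrite !mul0r addr0.
rewrite inv2_sumS IHk; last lia.
by rewrite inv1_sum_pos; [rewrite -natr1; field | lia].
Qed.

(* The base value comes from averaging over k: the sum of z^(kl) vanishes. *)
Lemma inv2_sum1 : inv2_sum 1 = - (m%:R ^+ 2 - 1) / 12.
Proof.
have S0 : \sum_(0 <= k < m) inv2_sum k.+1 = 0.
  rewrite /inv2_sum exchange_big_nat /= big_nat big1 // => l lm.
  rewrite -mulr_suml [X in X / _](_ : _ = 0) ?mul0r //.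
  under eq_bigr do rewrite mulSn exprD mulnC.
  rewrite -mulr_sumr sum_prim.
  have /negbTE-> : ~~ (m %| l)%N.
    by apply/negP => /dvdn_leq -/(_ (proj1 (andP lm))); lia.
  by rewrite muln0 mulr0.
have poly p : (p <= m)%N -> \sum_(0 <= k < p) inv2_sum k.+1 =
    p%:R * inv2_sum 1 + p%:R * (p%:R - 1) * (3 * m%:R - 2 * p%:R + 1) / 12.
  elim: p => [_|p IHp pm]; first by rewrite big_geq // !mul0r addr0.
  rewrite big_nat_recr //= IHp 1?ltnW // (inv2_sum_rec (ltnW pm)).
  rewrite -[p.+1%:R]natr1.
  by field.
have := poly m (leqnn _); rewrite S0 => /esym E.
apply: (mulfI m_neq0); apply/eqP; rewrite -subr_eq0 -[X in _ == X]E.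
by apply/eqP; field.
Qed.

(** Eigenvalue of the wave of frequency [k] in the frame attached to the roots: the frame adds one
    factor of the root, hence [inv2_sum k.+1]. *)
Definition sigma k : F := k%:R * (m%:R - k%:R) / 2 - (m%:R ^+ 2 - 1) / 12.

Lemma inv2_sumE k : (k <= m)%N -> inv2_sum k.+1 = sigma k.
Proof. by move=> km; rewrite inv2_sum_rec // inv2_sum1 /sigma; field. Qed.

Lemma inv2_sum0 : inv2_sum 0 = - ((m%:R - 1) * (m%:R - 5) / 12).
Proof.
(* [inv2_sumE] starts at exponent 1, so exponent 0 is replaced by [m], which gives the same
   summands. *)
have -> : inv2_sum 0 = inv2_sum m.
  rewrite /inv2_sum !big_nat; apply: eq_bigr => l _.
  by rewrite mul0n exprM (prim_expr_order prim_z) expr1n.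
have -> : inv2_sum m = sigma m.-1 by rewrite -inv2_sumE ?prednK ?leq_pred.
by rewrite /sigma -subn1 natrB //; field.
Qed.

Lemma sum_inv_sub i : (i < m)%N ->
  \sum_(0 <= j < m | j != i) (z ^+ i.+1 - z ^+ j.+1)^-1 =
  (m%:R - 1) / 2 / z ^+ i.+1.
Proof.
move=> im; rewrite (sum_prim_neq (fun w => (z ^+ i.+1 - w)^-1)) // -inv1_sum0.
rewrite mulr_suml !big_nat; apply: eq_bigr => l lm; rewrite mul0n expr0; field.
by rewrite prim_expr_neq1 // prim_neq0 prim_subM_neq0.
Qed.

Lemma sum_mode_sub a i : (i < m)%N ->
  \sum_(0 <= j < m | j != i) z ^+ (a * j.+1) / (z ^+ i.+1 - z ^+ j.+1) ^+ 2 =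
  inv2_sum a * z ^+ (a * i.+1) / z ^+ i.+1 ^+ 2.
Proof.
move=> im; under eq_bigr do rewrite mulnC exprM.
rewrite (sum_prim_neq (fun w => w ^+ a / (z ^+ i.+1 - w) ^+ 2)) //.
rewrite !mulr_suml !big_nat; apply: eq_bigr => l lm.
rewrite exprMn ![(a * _)%N]mulnC !exprM; field.
by rewrite prim_expr_neq1 // prim_neq0 prim_subM_neq0.
Qed.

End RootsOfUnitySums.

(** * Derivatives of the Hamiltonian along lines *)

Section LineDerivatives.
Context {R : realType} {V W : normedModType R}.

(** The two difference quotients agree, so derivatives in several variables reduce to one real
    variable. *)
Lemma is_derive_line (f : V -> W) (x v : V) (df : W) :
  is_derive (0 : R) (1 : R) (fun h : R => f (h *: v + x)) df ->
  is_derive x v f df.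
Proof.
move=> [d <-]; split; first exact: ((derivable1P f x v).2 d).
rewrite /derive; set g1 := fun h => h^-1 *: _; set g2 := fun h => h^-1 *: _.
suff -> : g1 = g2 by [].
by apply/funext => h; rewrite /g1 /g2 /= addr0 scale0r add0r [_%:A]mulr1.
Qed.

Lemma is_derive_bigsum (I : finType) (P : pred I) (h : I -> V -> W)
    (dh : I -> W) (x v : V) :
  (forall i, P i -> is_derive x v (h i) (dh i)) ->
  is_derive x v (fun y => \sum_(i | P i) h i y) (\sum_(i | P i) dh i).
Proof.
move=> hP; elim: (index_enum I) => [|i r IHr].
  rewrite big_nil (_ : (fun _ => _) = cst 0); first exact: is_derive_cst.
  by apply/funext => y; rewrite big_nil.
rewrite big_cons (_ : (fun _ => _) = fun y =>
    if P i then h i y + \sum_(j <- r | P j) h j y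
    else \sum_(j <- r | P j) h j y); last first.
  by apply/funext => y; rewrite big_cons.
by case: ifPn => // Pi; apply: is_deriveD; apply: hP.
Qed.

End LineDerivatives.

Section Plane.
Context {R : realType}.
Implicit Types (x a b : 'rV[R]_2) (h : R).

Definition dot a b := a 0 0 * b 0 0 + a 0 1 * b 0 1.
Definition sqn x := x 0 0 ^+ 2 + x 0 1 ^+ 2.

Lemma sqn_ge0 x : 0 <= sqn x.
Proof. by rewrite addr_ge0 // sqr_ge0. Qed.

Lemma sqn_eq0 x : (sqn x == 0) = (x == 0).
Proof.
apply/eqP/eqP => [/eqP|->]; last by rewrite /sqn !mxE expr0n addr0.
rewrite paddr_eq0 ?sqr_ge0 // !sqrf_eq0 => /andP[/eqP x0 /eqP x1].
apply/rowP => -[[|[|//]] i]; rewrite !mxE.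
  by rewrite (_ : Ordinal i = 0) //; exact/val_inj.
by rewrite (_ : Ordinal i = 1) //; exact/val_inj.
Qed.

Lemma enorm2 x : enorm x ^+ 2 = sqn x.
Proof. by rewrite sqr_sqrtr // sqn_ge0. Qed.

Lemma ln_enorm x : ln (enorm x) = 2^-1 * ln (sqn x).
Proof.
have [x0|x0] := eqVneq (sqn x) 0.
  by rewrite /enorm -/(sqn x) x0 sqrtr0 ln0 // mulr0.
have sqx0 : 0 < sqn x by rewrite lt_def x0 sqn_ge0.
by rewrite -enorm2 lnXn ?sqrtr_gt0 // [ln _ *+ 2]mulr2n; field.
Qed.

Lemma is_derive_affine (a b t : R) :
  is_derive t (1 : R) (fun h : R => h * a + b) a.
Proof.
have -> : (fun h : R => h * a + b) = (a *: id + cst b : R -> R).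
  by apply/funext => h /=; rewrite !fctE /= mulrC.
by apply: is_derive_eq; rewrite addr0 [_ *: 1]mulr1.
Qed.

Lemma is_derive_dot_line a b c :
  is_derive (0 : R) (1 : R) (fun h => dot a (h *: b + c)) (dot a b).
Proof.
have -> : (fun h => dot a (h *: b + c)) = (fun h => h * dot a b + dot a c).
  by apply/funext => h; rewrite /dot !mxE; ring.
exact: is_derive_affine.
Qed.

Lemma is_derive_sqn_line a b :
  is_derive (0 : R) (1 : R) (fun h => sqn (h *: a + b)) (2 * dot a b).
Proof.
have -> : (fun h => sqn (h *: a + b)) =
    ((fun h => h * a 0 0 + b 0 0) ^+ 2 + (fun h => h * a 0 1 + b 0 1) ^+ 2).
  by apply/funext => h; rewrite /sqn !mxE !fctE.
have d0 := is_derive_affine (a 0 0) (b 0 0) 0.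
have d1 := is_derive_affine (a 0 1) (b 0 1) 0.
apply: (is_derive_eq (is_deriveD (is_deriveX 2 d0) (is_deriveX 2 d1))).
by rewrite /dot /GRing.scale /= !mul0r !add0r !expr1; ring.
Qed.

Lemma is_derive_ln_enorm_line a b : b != 0 ->
  is_derive (0 : R) (1 : R) (fun h => ln (enorm (h *: a + b)))
    (dot a b / sqn b).
Proof.
rewrite -sqn_eq0 => b0.
have -> : (fun h => ln (enorm (h *: a + b))) =
    2^-1 *: (@ln R \o (fun h => sqn (h *: a + b))).
  by apply/funext => h; rewrite ln_enorm !fctE.
have sq0 : 0 < sqn (0 *: a + b).
  by rewrite scale0r add0r lt_def b0 sqn_ge0.
have dl := is_derive1_ln sq0; have dq := is_derive_sqn_line a b.
apply: is_derive_eq; rewrite scale0r add0r /GRing.scale /=; field.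
exact: b0.
Qed.

Lemma is_derive_dot_sqn_line a b c : c != 0 ->
  is_derive (0 : R) (1 : R) (fun h => dot a (h *: b + c) / sqn (h *: b + c))
    (dot a b / sqn c - 2 * dot a c * dot b c / sqn c ^+ 2).
Proof.
rewrite -sqn_eq0 => c0.
have sq0 : sqn (0 *: b + c) != 0 by rewrite scale0r add0r.
have dq := is_deriveV (f := fun h => sqn (h *: b + c)) sq0
  (is_derive_sqn_line b c).
have dd := is_derive_dot_line a b c.
apply: is_derive_eq; rewrite !scale0r !add0r /GRing.scale /=; field.
exact: c0.
Qed.

End Plane.

(** * First and second derivatives of the Hamiltonian *)

Section Hamiltonian.
Context {R : realType} {n : nat} (gam : 'I_n -> R).
Implicit Types Z U V : 'cV[R]_(\sum_(i < n) 2).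

Definition apart Z := forall i j, i != j -> position Z i - position Z j != 0.

Lemma position_line Z U h i j :
  position (h *: U + Z) i - position (h *: U + Z) j =
  h *: (position U i - position U j) + (position Z i - position Z j).
Proof. by apply/rowP => s; rewrite !mxE; ring. Qed.

(** The formula for the first derivative holds where no vortices collide; differentiating it again
    requires it on a neighbourhood. *)
Lemma near_apart Z : apart Z -> \forall W \near Z, apart W.
Proof.
move=> aZ.
suff nZ i j : \forall W \near Z, i != j ->
    position W i - position W j != 0.
  have nZi i : \forall W \near Z, forall j, i != j ->
      position W i - position W j != 0 by exact: (filter_forall _ (nZ i)).
  exact: (filter_forall _ nZi).
have [->|ij] := eqVneq i j; first by apply: (@filterE _ (nbhs Z)).
pose f (W : 'cV[R]_(\sum_(i < n) 2)) : R :=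
  sqn (position W i - position W j).
have cf : {for Z, continuous f}.
  have -> : f = fun W => (W (tagnat.Rank i 0) 0 - W (tagnat.Rank j 0) 0) ^+ 2 +
      (W (tagnat.Rank i 1) 0 - W (tagnat.Rank j 1) 0) ^+ 2.
    by apply/funext => W; rewrite /f /sqn !mxE.
  have cc p q : {for Z, continuous (fun W : 'cV[R]_(\sum_(i < n) 2) =>
      (W p 0 - W q 0) ^+ 2)}.
    apply: (@continuous_comp _ _ _ (fun W : 'cV[R]_(\sum_(i < n) 2) =>
      W p 0 - W q 0) (fun x : R => x ^+ 2)); last exact: exprn_continuous.
    by apply: continuousB; exact: coord_continuous.
  by apply: continuousD; exact: cc.
have f0 : f Z != 0 by rewrite sqn_eq0 aZ.
near=> W => _; rewrite -sqn_eq0; near: W; exact: cvgr_neq0 cf f0.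
Unshelve. all: by end_near. Qed.

Lemma is_derive_H Z U : apart Z ->
  is_derive Z U (H gam) (2^-1 * \sum_(i < n) \sum_(j < n | j != i)
    gam i * gam j * (dot (position U i - position U j)
      (position Z i - position Z j) / sqn (position Z i - position Z j))).
Proof.
move=> aZ; apply: is_derive_line; rewrite /H.
have -> : (fun h : R => 2^-1 * \sum_(i < n) \sum_(j < n | j != i)
    gam i * gam j * ln (enorm (position (h *: U + Z) i -
      position (h *: U + Z) j))) =
    2^-1 *: (fun h : R => \sum_(i < n) \sum_(j < n | j != i)
    ((gam i * gam j) *: (fun h => ln (enorm (h *: (position U i - position U j)
      + (position Z i - position Z j))))) h).
  apply/funext => h; congr (_ * _); apply: eq_bigr => i _.
  by apply: eq_bigr => j _; rewrite position_line.
apply: is_deriveZ; apply: is_derive_bigsum => i _.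
apply: is_derive_bigsum => j ij; apply: is_deriveZ.
by apply: is_derive_ln_enorm_line; rewrite aZ // eq_sym.
Qed.

Lemma is_derive_dH Z U V : apart Z ->
  is_derive Z V (fun W => 'D_U (H gam) W)
   (2^-1 * \sum_(i < n) \sum_(j < n | j != i) gam i * gam j *
     let z := position Z i - position Z j in
     let u := position U i - position U j in
     let v := position V i - position V j in
     (dot u v / sqn z - 2 * dot u z * dot v z / sqn z ^+ 2)).
Proof.
move=> aZ; pose F W := 2^-1 * \sum_(i < n) \sum_(j < n | j != i)
    gam i * gam j * (dot (position U i - position U j)
      (position W i - position W j) / sqn (position W i - position W j)).
apply: (@near_eq_is_derive _ _ _ F).
  apply: filterS (near_apart aZ) => W aW; rewrite /F.
  by have [_ ->] := is_derive_H U aW.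
apply: is_derive_line; rewrite /F.
have -> : (fun h : R => 2^-1 * \sum_(i < n) \sum_(j < n | j != i)
    gam i * gam j * (dot (position U i - position U j)
      (position (h *: V + Z) i - position (h *: V + Z) j) /
      sqn (position (h *: V + Z) i - position (h *: V + Z) j))) =
    2^-1 *: (fun h : R => \sum_(i < n) \sum_(j < n | j != i)
    ((gam i * gam j) *: (fun h => dot (position U i - position U j)
      (h *: (position V i - position V j) + (position Z i - position Z j)) /
      sqn (h *: (position V i - position V j)
        + (position Z i - position Z j)))) h).
  apply/funext => h; congr (_ * _); apply: eq_bigr => i _.
  by apply: eq_bigr => j _; rewrite position_line.
apply: is_deriveZ; apply: is_derive_bigsum => i _.
apply: is_derive_bigsum => j ij; apply: is_deriveZ.
by apply: is_derive_dot_sqn_line; rewrite aZ // eq_sym.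
Qed.

End Hamiltonian.

(** * The plane and the configuration space in complex coordinates *)

Section ComplexPlane.
Context {R : realType}.
Implicit Types (x u : 'rV[R]_2) (w v : R[i]).
Local Notation pc := (@plane_of_complex R).

Definition toC x : R[i] := Complex (x 0 0) (x 0 1).

Lemma complex_ext v w : Re v = Re w -> Im v = Im w -> v = w.
Proof. by case: v => a b; case: w => c d /= -> ->. Qed.

Lemma row2P x u : x 0 0 = u 0 0 -> x 0 1 = u 0 1 -> x = u.
Proof.
move=> e0 e1; apply/rowP => -[[|[|//]] i].
  by rewrite (_ : Ordinal i = 0) //; exact/val_inj.
by rewrite (_ : Ordinal i = 1) //; exact/val_inj.
Qed.

Lemma toCK x : pc (toC x) = x.
Proof. by apply: row2P; rewrite !mxE. Qed.

Lemma pcK w : toC (pc w) = w.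
Proof. by apply: complex_ext; rewrite /= !mxE. Qed.

Lemma toCB x u : toC (x - u) = toC x - toC u.
Proof. by apply: complex_ext; rewrite /= !mxE. Qed.

Lemma toC0 : toC 0 = 0.
Proof. by apply: complex_ext; rewrite /= !mxE. Qed.

Lemma toC_eq0 x : (toC x == 0) = (x == 0).
Proof.
apply/eqP/eqP => [e|->]; last exact: toC0.
by rewrite -[x]toCK e -toC0 toCK.
Qed.

Lemma toC_neq0 x : x != 0 -> toC x != 0. Proof. by rewrite toC_eq0. Qed.

Lemma pcB v w : pc (v - w) = pc v - pc w.
Proof. by rewrite -[RHS]toCK toCB !pcK. Qed.

Lemma conjcD v w : (v + w)^~ = v^~ + w^~.
Proof. exact: rmorphD. Qed.

Lemma conjcM v w : (v * w)^~ = v^~ * w^~.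
Proof. exact: rmorphM. Qed.

Lemma conjcN w : (- w)^~ = - w^~.
Proof. exact: rmorphN. Qed.

Lemma conjcX w k : (w ^+ k)^~ = w^~ ^+ k.
Proof. exact: rmorphXn. Qed.

Lemma conjc_sum (I : Type) (r : seq I) (P : pred I) (f : I -> R[i]) :
  (\sum_(i <- r | P i) f i)^~ = \sum_(i <- r | P i) (f i)^~.
Proof. exact: rmorph_sum. Qed.

Lemma conjcZ (c : R) w : (c%:C * w)^~ = c%:C * w^~.
Proof. by rewrite conjcM conjc_real. Qed.

Lemma Re_sum (I : Type) (r : seq I) (P : pred I) (f : I -> R[i]) :
  Re (\sum_(i <- r | P i) f i) = \sum_(i <- r | P i) Re (f i).
Proof. by apply: (big_morph (@Re R)) => // -[a b] [c d]. Qed.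

Lemma Im_sum (I : Type) (r : seq I) (P : pred I) (f : I -> R[i]) :
  Im (\sum_(i <- r | P i) f i) = \sum_(i <- r | P i) Im (f i).
Proof. by apply: (big_morph (@Im R)) => // -[a b] [c d]. Qed.

Definition rdot v w : R := Re v * Re w + Im v * Im w.

Lemma rdot_sum (I : Type) (r : seq I) (P : pred I) v (f : I -> R[i]) :
  rdot v (\sum_(i <- r | P i) f i) = \sum_(i <- r | P i) rdot v (f i).
Proof. by rewrite /rdot Re_sum Im_sum !mulr_sumr -big_split. Qed.

Lemma rdotZr v (c : R) w : rdot v (c%:C * w) = c * rdot v w.
Proof. by case: v w => a b [d e]; rewrite /rdot /=; ring. Qed.

Lemma rdot_conjM v w : rdot v w = Re (v^~ * w).
Proof. by case: v w => a b [d e]; rewrite /rdot /=; ring. Qed.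

Lemma dotE x u : dot x u = rdot (toC x) (toC u).
Proof. by []. Qed.

Lemma sqn_neq0 x : toC x != 0 -> x 0 0 ^+ 2 + x 0 1 ^+ 2 != 0.
Proof. by rewrite toC_eq0 -sqn_eq0. Qed.

(** [K] is antiholomorphic: [x^perp / |x|^2] is [ci] times the conjugate of [1 / x]. *)
Lemma toC_K x : toC (K x) = ci * ((2 * pi)^-1)%:C * (toC x)^-1^~.
Proof.
(* At 0 both sides vanish: [perp 0] is 0, and the inverse of 0 is 0 by convention. *)
have [->|x0] := eqVneq x 0.
  rewrite toC0 invr0 conjc0 mulr0 /K (_ : perp 0 = 0) ?scaler0 ?toC0 //.
  by apply: row2P; rewrite !mxE ?oppr0.
have p0 : (pi : R) != 0 by rewrite gt_eqF // pi_gt0.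
have s0 := sqn_neq0 (toC_neq0 x0).
apply: complex_ext; rewrite /K enorm2 /sqn /= !mxE /=.
- by move: (pi : R) p0 => p p0; field; rewrite ?s0 ?p0.
- by move: (pi : R) p0 => p p0; field; rewrite ?s0 ?p0.
Qed.

Lemma Re_toC_invsq x : Re ((toC x)^-2) =
  (x 0 0 ^+ 2 - x 0 1 ^+ 2) / (x 0 0 ^+ 2 + x 0 1 ^+ 2) ^+ 2.
Proof. by rewrite /=; congr (_ / _); ring. Qed.

Lemma Im_toC_invsq x : Im ((toC x)^-2) =
  - (2 * x 0 0 * x 0 1) / (x 0 0 ^+ 2 + x 0 1 ^+ 2) ^+ 2.
Proof. by rewrite /= -mulNr; congr (_ / _); ring. Qed.

Lemma mulmx_row2 k (v : 'rV[R]_2) (M : 'M[R]_(2, k)) j :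
  (v *m M) 0 j = v 0 0 * M 0 j + v 0 1 * M 1 j.
Proof.
rewrite mxE big_ord_recl big_ord1.
by congr (v _ _ * M _ _ + v _ _ * M _ _); exact/val_inj.
Qed.

(* The matrix of h |-> conj ('i * w * h): K is antiholomorphic, and its
   Jacobian matrix at x is this one for w = (2 pi)^-1 x^-2. *)
Definition strainmx w : 'M[R]_2 := \matrix_(i < 2, j < 2)
  if i == 0 then if j == 0 then - Im w else - Re w
  else if j == 0 then - Re w else Im w.

Lemma is_derive_div_sqn (a b : R) x (v : 'rV[R]_2) : x != 0 ->
  is_derive x v (fun y => (2 * pi * enorm y ^+ 2)^-1 * dot (pc (Complex a b)) y)
    ((2 * pi)^-1 * (dot (pc (Complex a b)) v / sqn x
      - 2 * dot (pc (Complex a b)) x * dot v x / sqn x ^+ 2)).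
Proof.
move=> x0; apply: is_derive_line.
have -> : (fun h : R => (2 * pi * enorm (h *: v + x) ^+ 2)^-1 *
      dot (pc (Complex a b)) (h *: v + x)) =
    (2 * pi)^-1 *:
    (fun h : R => dot (pc (Complex a b)) (h *: v + x) / sqn (h *: v + x)).
  by apply/funext => h; rewrite enorm2 invfM -mulrA [_ * dot _ _]mulrC.
by apply: is_deriveZ; apply: is_derive_dot_sqn_line.
Qed.

Lemma K0E x : K x 0 0 =
  (2 * pi * enorm x ^+ 2)^-1 * dot (pc (Complex 0 (-1))) x.
Proof. by rewrite /K /dot !mxE /=; ring. Qed.

Lemma K1E x : K x 0 1 =
  (2 * pi * enorm x ^+ 2)^-1 * dot (pc (Complex 1 0)) x.
Proof. by rewrite /K /dot !mxE /=; ring. Qed.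

Lemma is_derive_K x (v : 'rV[R]_2) : x != 0 ->
  is_derive x v (@K R) (v *m ((2 * pi)^-1 *: strainmx ((toC x)^-2))).
Proof.
move=> x0.
have d0 := is_derive_div_sqn 0 (-1) v x0.
have d1 := is_derive_div_sqn 1 0 v x0.
have E0 : (fun y => K y 0 0) = fun y =>
    (2 * pi * enorm y ^+ 2)^-1 * dot (pc (Complex 0 (-1))) y.
  by apply/funext => y; exact: K0E.
have E1 : (fun y => K y 0 1) = fun y =>
    (2 * pi * enorm y ^+ 2)^-1 * dot (pc (Complex 1 0)) y.
  by apply/funext => y; exact: K1E.
rewrite -E0 in d0; rewrite -E1 in d1.
have dK : derivable (@K R) x v.
  apply/derivable_mxP => i [[|[|//]] j]; rewrite (ord1 i).
    by rewrite (_ : Ordinal j = 0); [case: d0 | exact/val_inj].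
  by rewrite (_ : Ordinal j = 1); [case: d1 | exact/val_inj].
have p0 : (pi : R) != 0 by rewrite gt_eqF // pi_gt0.
have s0 := sqn_neq0 (toC_neq0 x0).
split=> //; rewrite derive_mx //; apply: row2P;
  rewrite mulmx_row2 !mxE Re_toC_invsq Im_toC_invsq.
  case: d0 => _ ->; rewrite /dot /sqn !mxE /=.
  by move: (pi : R) p0 => p p0; field; rewrite ?s0 ?p0.
case: d1 => _ ->; rewrite /dot /sqn !mxE /=.
by move: (pi : R) p0 => p p0; field; rewrite ?s0 ?p0.
Qed.

(** [jacobian] is built on the differential, which directional derivatives alone do not provide;
    away from 0 the entries of [K] are quotients of polynomials. *)
Lemma differentiable_K x : x != 0 -> differentiable (@K R) x.
Proof.
move=> x0.
pose q (y : 'rV[R]_2) := y 0 0 * y 0 0 + y 0 1 * y 0 1.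
have qE y : q y = sqn y by rewrite /q /sqn !expr2.
have -> : @K R = fun y => ((2 * pi * q y)^-1 * - y 0 1) *: delta_mx 0 0
    + ((2 * pi * q y)^-1 * y 0 0) *: delta_mx 0 1.
  apply/funext => y; rewrite qE /K enorm2.
  by apply: row2P; rewrite !mxE /=; ring.
have p0 : (pi : R) != 0 by rewrite gt_eqF // pi_gt0.
have dq : differentiable (fun y : 'rV[R]_2 => (2 * pi * q y)^-1) x.
  apply: differentiableV; last by rewrite !mulf_neq0 ?pnatr_eq0 ?qE ?sqn_eq0.
  apply: differentiableM => //; apply: differentiableD;
    apply: differentiableM; exact: differentiable_coord.
apply: differentiableD; apply: differentiableZl; apply: differentiableM => //.
  by apply: differentiableN; exact: differentiable_coord.
exact: differentiable_coord.
Qed.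

(** [strainmx] is symmetric, which absorbs the transposition in [JK]. *)
Lemma JK_strainmx x : x != 0 ->
  JK x = (2 * pi)^-1 *: strainmx ((toC x)^-2).
Proof.
move=> x0; apply/matrixP => i j; rewrite /JK /jacobian !mxE.
rewrite -deriveE; last exact: differentiable_K.
have [_ ->] := is_derive_K (delta_mx 0 j) x0.
rewrite -rowE !mxE; case: i => -[|[|//]] ip; case: j => -[|[|//]] jp //=.
Qed.

(** Real linearity reduces the matrix condition of zero strain to one complex sum. *)
Lemma strainmx_sum (I : Type) (r : seq I) (P : pred I) (f : I -> R[i])
    (g : I -> R) :
  strainmx (\sum_(i <- r | P i) (g i)%:C * f i) =
  \sum_(i <- r | P i) g i *: strainmx (f i).
Proof.
apply/matrixP => i j; rewrite summxE !mxE Re_sum Im_sum -!sumrN.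
by case: ifP => i0; case: ifP => j0; apply: eq_bigr => k _;
  rewrite !mxE i0 j0; case: (f k) => a b /=; ring.
Qed.

Lemma strainmx0 : strainmx 0 = 0.
Proof. by apply/matrixP => i j; rewrite !mxE /= !oppr0 !if_same. Qed.

End ComplexPlane.

(** * Configurations as complex vectors *)

Section Configurations.
Context {R : realType} {n : nat}.
Implicit Types (y z : 'I_n -> R[i]).

Definition cfg y : 'cV[R]_(\sum_(i < n) 2) :=
  config (fun i => plane_of_complex (y i)).

Definition coords (Z : 'cV[R]_(\sum_(i < n) 2)) (i : 'I_n) : R[i] :=
  toC (position Z i).

Lemma position_config (z : 'I_n -> 'rV[R]_2) i : position (config z) i = z i.
Proof. by rewrite /position mxcolK trmxK. Qed.

Lemma cfgK y : coords (cfg y) = y.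
Proof. by apply/funext => i; rewrite /coords position_config pcK. Qed.

Lemma coordsK Z : cfg (coords Z) = Z.
Proof.
rewrite /cfg /config -[RHS]submxcolK; apply: eq_mxcol => i.
by rewrite toCK trmxK.
Qed.

Lemma cfg_inj y z : cfg y = cfg z -> y = z.
Proof. by move=> e; rewrite -(cfgK y) e cfgK. Qed.

Lemma eq_cfg y z : y =1 z -> cfg y = cfg z.
Proof. by move=> /funext ->. Qed.

Lemma cfgD y z : cfg y + cfg z = cfg (fun i => y i + z i).
Proof.
rewrite /cfg /config -mxcolD; apply: eq_mxcol => i.
by rewrite -linearD -[_ + _ in LHS]toCK; congr (plane_of_complex _)^T;
   apply: complex_ext; rewrite /= !mxE /=; case: (y i) (z i) => a b [].
Qed.

Lemma cfgZ (a : R) y : a *: cfg y = cfg (fun i => a%:C * y i).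
Proof.
apply/matrixP => p j; rewrite /cfg /config !mxE.
by case: (y _) => c d; case: ifP => _ /=; ring.
Qed.

Lemma cfg0 : cfg (fun=> 0) = 0.
Proof.
rewrite -[LHS]scale1r -(scale0r (cfg (fun=> 0))) !cfgZ.
by apply: eq_cfg => i; rewrite !mulr0.
Qed.

Lemma pairing X y :
  (X^T *m cfg y) 0 0 = \sum_(i < n) rdot (coords X i) (y i).
Proof.
rewrite /cfg /config -[X in X^T]submxcolK tr_mxcol mul_mxrow_mxcol summxE.
apply: eq_bigr => i _; rewrite !mxE big_ord_recl big_ord1 /rdot !mxE /=.
by rewrite /position !mxE; congr (_ + X (tagnat.Rank i _) 0 * _);
  exact/val_inj.
Qed.

(** Entries become pairings with basis vectors, the form in which directional derivatives appear. *)
Lemma cfg_entry y p :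
  cfg y p 0 = \sum_(i < n) rdot (coords (delta_mx p 0) i) (y i).
Proof. by rewrite -pairing trmx_delta -rowE [RHS]mxE. Qed.

Lemma Jmx_cfg y : Jmx R n *m cfg y = cfg (fun i => ci * y i).
Proof.
rewrite /Jmx /cfg /config mul_mxdiag_mxcol; apply: eq_mxcol => i.
apply/matrixP => s j; rewrite !mxE big_ord_recl big_ord1 !mxE /=.
case: (y i) => a b; case: s => -[|[|//]] s0 /=; ring.
Qed.

Lemma Gammamx_cfg (gam : 'I_n -> R) y :
  Gammamx gam *m cfg y = cfg (fun i => (gam i)%:C * y i).
Proof.
rewrite /Gammamx /cfg /config mul_mxdiag_mxcol; apply: eq_mxcol => i.
rewrite mul_scalar_mx; apply/matrixP => s j; rewrite !mxE.
by case: (y i) => a b; case: ifP => _ /=; ring.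
Qed.

End Configurations.

(** * Gradient and Hessian at a configuration *)

Section Kernels.
Context {R : realType}.

(** The gradient of [ln |w|] is [w / |w|^2], the conjugate of [1 / w]; [rdot_inv2] is the
    corresponding second derivative, from [- 1 / w^2]. *)
Lemma rdot_inv (d w : R[i]) : w != 0 ->
  rdot d w / sqn (plane_of_complex w) = rdot d (w^-1)^~.
Proof.
rewrite -{1}[w]pcK => /sqn_neq0; rewrite /sqn /rdot !mxE /=.
by case: w d => a b [c d] /= ab0; field.
Qed.

Lemma rdot_inv2 (u v : 'rV[R]_2) (w : R[i]) : w != 0 ->
  dot u v / sqn (plane_of_complex w) - 2 * dot u (plane_of_complex w)
    * dot v (plane_of_complex w) / sqn (plane_of_complex w) ^+ 2 =
  rdot (toC v) (- (toC u / w ^+ 2)^~).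
Proof.
move=> w0; have s0 : sqn (plane_of_complex w) != 0.
  by apply: sqn_neq0; rewrite pcK.
have -> : w ^- 2 = Complex
     (((Re w) ^+ 2 - (Im w) ^+ 2) / sqn (plane_of_complex w) ^+ 2)
     (- (2 * Re w * Im w) / sqn (plane_of_complex w) ^+ 2).
  have := (Re_toC_invsq (plane_of_complex w),
    Im_toC_invsq (plane_of_complex w)).
  by rewrite pcK => -[eR eI]; apply: complex_ext; rewrite ?eR ?eI /sqn !mxE.
move: s0; rewrite /sqn /rdot /dot !mxE /=.
by case: w w0 => a b _ /= ab0; field.
Qed.

End Kernels.

Section Linearization.
Context {R : realType} {n : nat} (gam : 'I_n -> R) (z : 'I_n -> R[i]).
Hypothesis z_inj : injective z.
Implicit Types (y : 'I_n -> R[i]) (U V : 'cV[R]_(\sum_(i < n) 2)).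

(** The velocity of vortex [i] is [ci / (2 pi)] times the conjugate of this sum. *)
Definition field_at i := \sum_(j < n | j != i) (gam j)%:C * (z i - z j)^-1.

Definition hess_op y i := - (gam i)%:C *
  (\sum_(j < n | j != i) (gam j)%:C * ((y i - y j) / (z i - z j) ^+ 2))^~.

Lemma sub_neq0 i j : i != j -> z i - z j != 0.
Proof. by move=> ij; rewrite subr_eq0 (inj_eq z_inj). Qed.

Lemma apart_cfg : apart (cfg z).
Proof.
move=> i j ij; rewrite !position_config -pcB -toC_eq0 pcK.
exact: sub_neq0.
Qed.

(** Exchanging [i] and [j] shows that the two halves of [u i - u j] contribute equally, which
    cancels [2^-1] and turns the sum over pairs into a sum over vortices. *)
Lemma pair_antisym (u D : 'I_n -> R[i]) (E : 'I_n -> 'I_n -> R[i]) :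
  (forall i j, E j i = - E i j) ->
  (forall i, D i = (gam i)%:C * \sum_(j < n | j != i) (gam j)%:C * E i j) ->
  2^-1 * \sum_(i < n) \sum_(j < n | j != i)
    gam i * gam j * rdot (u i - u j) (E i j) = \sum_(i < n) rdot (u i) (D i).
Proof.
move=> Ea DE.
pose A i j := gam i * gam j * rdot (u i) (E i j).
have DA : \sum_(i < n) rdot (u i) (D i) =
    \sum_(i < n) \sum_(j < n | j != i) A i j.
  apply: eq_bigr => i _; rewrite DE rdotZr rdot_sum mulr_sumr.
  by apply: eq_bigr => j _; rewrite rdotZr mulrA.
have -> : \sum_(i < n) \sum_(j < n | j != i)
      gam i * gam j * rdot (u i - u j) (E i j) =
    \sum_(i < n) \sum_(j < n | j != i) A i j +
    \sum_(i < n) \sum_(j < n | j != i) A j i.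
  rewrite -big_split; apply: eq_bigr => i _; rewrite -big_split /=.
  apply: eq_bigr => j _; rewrite /A (Ea i j) /rdot.
  by case: (u i) (u j) (E i j) => a b [c d] [e f] /=; ring.
have -> : \sum_(i < n) \sum_(j < n | j != i) A j i =
    \sum_(i < n) \sum_(j < n | j != i) A i j.
  rewrite (exchange_big_dep xpredT) //=; apply: eq_bigr => i _.
  by apply: eq_bigl => j; rewrite eq_sym.
by rewrite DA; field.
Qed.

Lemma gradient_cfg : gradient (H gam) (cfg z) =
  cfg (fun i => (gam i)%:C * (field_at i)^~).
Proof.
apply/colP => p; rewrite mxE cfg_entry.
have [_ ->] := is_derive_H gam (delta_mx p 0) apart_cfg.
rewrite -(@pair_antisym _ _ (fun i j => ((z i - z j)^-1)^~)); first last.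
- move=> i; rewrite /field_at conjc_sum; congr (_ * _).
  by apply: eq_bigr => j _; rewrite conjcZ.
- by move=> i j; rewrite -opprB invrN conjcN.
congr (_ * _); apply: eq_bigr => i _; apply: eq_bigr => j ji.
rewrite !position_config -pcB dotE toCB pcK; congr (_ * _).
by rewrite rdot_inv // sub_neq0 // eq_sym.
Qed.

Definition hess_form U V :=
  \sum_(i < n) rdot (coords V i) (hess_op (coords U) i).

Lemma hess_formE U V : 2^-1 * (\sum_(i < n) \sum_(j < n | j != i)
   gam i * gam j *
     let z := position (cfg z) i - position (cfg z) j in
     let u := position U i - position U j in
     let v := position V i - position V j in
     (dot u v / sqn z - 2 * dot u z * dot v z / sqn z ^+ 2)) = hess_form U V.
Proof.
rewrite /hess_form -(@pair_antisym _ _ (fun i j =>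
  - ((coords U i - coords U j) / (z i - z j) ^+ 2)^~)); first last.
- move=> i; rewrite /hess_op conjc_sum mulNr -mulrN -sumrN; congr (_ * _).
  by apply: eq_bigr => j _; rewrite conjcZ mulrN.
- move=> i j; rewrite -(opprB (coords U j)) -(opprB (z j)) sqrrN mulNr.
  by rewrite conjcN opprK.
congr (_ * _); apply: eq_bigr => i _; apply: eq_bigr => j ji /=.
rewrite !position_config -pcB /coords -!toCB; congr (_ * _).
by rewrite rdot_inv2 // sub_neq0 // eq_sym.
Qed.

(** Symmetry of second derivatives, visible on the pair formula, where [u] and [v] can be
    exchanged. *)
Lemma hess_formC U V : hess_form U V = hess_form V U.
Proof.
rewrite -!hess_formE; congr (_ * _).
apply: eq_bigr => i _; apply: eq_bigr => j _; congr (_ * _) => /=.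
by rewrite /dot; ring.
Qed.

Lemma hessian_cfg y : hessian (H gam) (cfg z) *m cfg y = cfg (hess_op y).
Proof.
(* Entry [(p, q)] is the form on basis vectors [q] and [p]; symmetry turns it into coordinate [q] of
   the operator at basis vector [p]. *)
have hE p q : hessian (H gam) (cfg z) p q =
    cfg (hess_op (coords (delta_mx p 0))) q 0.
  rewrite mxE.
  have [_ ->] := is_derive_dH gam (delta_mx q 0) (delta_mx p 0) apart_cfg.
  by rewrite hess_formE hess_formC cfg_entry.
apply/colP => p; rewrite mxE cfg_entry.
under eq_bigr do rewrite hE.
have := hess_formC (delta_mx p 0) (cfg y); rewrite /hess_form cfgK => <-.
have := pairing (cfg y) (hess_op (coords (delta_mx p 0))).
rewrite cfgK => <-; rewrite mxE; apply: eq_bigr => q _.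
by rewrite mulrC !mxE.
Qed.

Hypothesis gam_neq0 : forall i, gam i != 0.

Lemma Gammamx_unit : Gammamx gam \in unitmx.
Proof.
rewrite -unitmx_tr -row_free_unit; apply: inj_row_free => v.
rewrite -[v]trmxK -trmx_mul -[v^T]coordsK Gammamx_cfg => /(congr1 trmx).
rewrite trmxK trmx0 -cfg0 => /cfg_inj e.
rewrite -[RHS]trmx0 -cfg0; congr trmx; apply: eq_cfg => i.
have /eqP := congr1 (@^~ i) e; rewrite /= mulf_eq0 => /orP[|/eqP //].
by rewrite eq_complex /= (negbTE (gam_neq0 i)).
Qed.

Lemma invGammamx_cfg y :
  invmx (Gammamx gam) *m cfg y = cfg (fun i => (gam i)%:C^-1 * y i).
Proof.
apply: (can_inj (mulKmx Gammamx_unit)).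
rewrite mulKVmx ?Gammamx_unit // Gammamx_cfg; apply: eq_cfg => i.
by rewrite mulVKf // eq_complex /= (negbTE (gam_neq0 i)).
Qed.

Hypothesis zero_strain_z : forall i,
  \sum_(j < n | j != i) (gam j)%:C * (z i - z j)^-2 = 0.

Definition lin_op (nu : R) y i := ci *
  ((\sum_(j < n | j != i) (gam j)%:C * (y j / (z i - z j) ^+ 2))^~
    + nu%:C * y i).

Lemma Smx_cfg nu y : Smx gam (cfg z) nu *m cfg y = cfg (lin_op nu y).
Proof.
rewrite /Smx mulmxDl -!mulmxA -scalemxAl hessian_cfg !Jmx_cfg invGammamx_cfg.
rewrite cfgZ cfgD; apply: eq_cfg => i.
have g0 : (gam i)%:C != 0 by rewrite eq_complex /= (negbTE (gam_neq0 i)).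
rewrite /hess_op (_ : \sum_(j < n | j != i) _ =
  - \sum_(j < n | j != i) (gam j)%:C * (y j / (z i - z j) ^+ 2)).
  by rewrite conjcN /= /lin_op; field.
(* Zero strain kills the coefficient of [y i], leaving only the displacements of the other
   vortices. *)
have /(congr1 (fun w => y i * w)) := zero_strain_z i.
rewrite mulr0 mulr_sumr => e0; rewrite -[RHS]add0r -[X in X - _]e0 -sumrB.
by apply: eq_bigr => j _; ring.
Qed.

End Linearization.

(** * The point-vortex flow *)

Section PlaneCalculus.
Context {R : realType}.

Lemma is_derive_row2 (f : R -> 'rV[R]_2) (t : R) (df : 'rV[R]_2) :
  is_derive t (1 : R) (fun s => f s 0 0) (df 0 0) ->
  is_derive t (1 : R) (fun s => f s 0 1) (df 0 1) ->
  is_derive t (1 : R) f df.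
Proof.
move=> d0 d1; have df' : derivable f t 1.
  apply/derivable_mxP => i [[|[|//]] j]; rewrite (ord1 i).
    by rewrite (_ : Ordinal j = 0); [case: d0 | exact/val_inj].
  by rewrite (_ : Ordinal j = 1); [case: d1 | exact/val_inj].
split=> //; rewrite derive_mx //; apply: row2P; rewrite !mxE.
  by case: d0.
by case: d1.
Qed.

Lemma is_derive_entry (f : R -> 'rV[R]_2) (t : R) (df : 'rV[R]_2) i :
  is_derive t (1 : R) f df -> is_derive t (1 : R) (fun s => f s 0 i) (df 0 i).
Proof.
move=> [d <-]; split; first exact: ((derivable_mxP f t 1).1 d).
by rewrite derive_mx // !mxE.
Qed.

Lemma is_derive_sqn (f : R -> 'rV[R]_2) (t : R) (df : 'rV[R]_2) :
  is_derive t (1 : R) f df ->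
  is_derive t (1 : R) (fun s => sqn (f s)) (2 * dot (f t) df).
Proof.
move=> d; have d0 := is_derive_entry 0 d; have d1 := is_derive_entry 1 d.
have -> : (fun s => sqn (f s)) =
    ((fun s => f s 0 0) ^+ 2 + (fun s => f s 0 1) ^+ 2).
  by apply/funext.
apply: (is_derive_eq (is_deriveD (is_deriveX 2 d0) (is_deriveX 2 d1))).
by rewrite /dot /GRing.scale /= !expr1; ring.
Qed.

Lemma cvg_sqn (T : Type) (F : set_system T) {FF : Filter F}
    (f : T -> 'rV[R]_2) (l : 'rV[R]_2) :
  f @ F --> l -> (fun s => sqn (f s)) @ F --> sqn l.
Proof.
move=> fl; have fc i : (fun s => f s 0 i) @ F --> l 0 i.
  exact: (cvg_comp _ _ fl (@coord_continuous _ _ _ 0 i l)).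
have -> : (fun s => sqn (f s)) =
    (fun s => f s 0 0 * f s 0 0) + (fun s => f s 0 1 * f s 0 1).
  by apply/funext => s; rewrite /sqn !expr2.
by rewrite /sqn !expr2; apply: cvgD; apply: cvgM.
Qed.

Lemma cvg_bigsum (T : Type) (F : set_system T) {FF : Filter F} (I : finType)
    (P : pred I) (f : I -> T -> R) (l : I -> R) :
  (forall i, P i -> f i @ F --> l i) ->
  (fun s => \sum_(i | P i) f i s) @ F --> \sum_(i | P i) l i.
Proof.
move=> fl; elim: (index_enum I) => [|i r IHr].
  rewrite big_nil (_ : (fun _ => _) = cst 0); first exact: cvg_cst.
  by apply/funext => s; rewrite big_nil.
rewrite big_cons (_ : (fun _ => _) = fun s =>
    if P i then f i s + \sum_(j <- r | P j) f j s
    else \sum_(j <- r | P j) f j s); last first.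
  by apply/funext => s; rewrite big_cons.
by case: ifPn => // Pi; apply: cvgD => //; apply: fl.
Qed.

(* conj (K a - K b) is a multiple of 1/a - 1/b = (b - a)/(ab). *)
Lemma sqn_KB (a b : 'rV[R]_2) : a != 0 -> b != 0 ->
  sqn (K a - K b) = sqn (a - b) / (4 * pi ^+ 2 * sqn a * sqn b).
Proof.
move=> a0 b0; rewrite /K !enorm2 /sqn !mxE /=.
have := a0; rewrite -sqn_eq0; have := b0; rewrite -sqn_eq0; rewrite /sqn.
have : (pi : R) != 0 by rewrite gt_eqF // pi_gt0.
move: (pi : R) (a 0 0) (a 0 1) (b 0 0) (b 0 1) => p a1 a2 b1 b2 p0 h1 h2.
by field; rewrite ?p0 ?h1 ?h2.
Qed.

Lemma dot_young (u v : 'rV[R]_2) : 2 * dot u v <= sqn u + sqn v.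
Proof.
rewrite -subr_ge0 (_ : _ - _ = sqn (u - v)) ?sqn_ge0 //.
by rewrite /sqn /dot !mxE; ring.
Qed.

Lemma sqnB_le (u v : 'rV[R]_2) : sqn (u - v) <= 2 * sqn u + 2 * sqn v.
Proof.
rewrite -subr_ge0 (_ : _ - _ = sqn (u + v)) ?sqn_ge0 //.
by rewrite /sqn !mxE; ring.
Qed.

(** The function [exp (- M t) D t] does not increase. *)
Lemma gronwall0 (D dD : R -> R) (M T : R) : 0 <= T ->
  {within `[0, T], continuous D} ->
  (forall t, 0 < t < T -> is_derive t (1 : R) D (dD t)) ->
  (forall t, 0 < t < T -> dD t <= M * D t) ->
  D 0 = 0 -> D T <= 0.
Proof.
move=> T0 cD dDP dDle D0.
pose G := (fun t => expR (t * - M + 0)) * D : R -> R.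
have dG t : 0 < t < T -> is_derive t (1 : R) G
    (expR (t * - M + 0) * (dD t - M * D t)).
  move=> tT; have d1 := dDP t tT.
  have d2 := is_derive1_comp (is_derive_expR _) (is_derive_affine (- M) 0 t).
  apply: (is_derive_eq (is_deriveM d2 d1)).
  by rewrite /GRing.scale /=; ring.
have cE : continuous (fun t : R => expR (t * - M + 0)).
  move=> t; apply: differentiable_continuous; apply/derivable1_diffP.
  by case: (is_derive1_comp (is_derive_expR _) (is_derive_affine (- M) 0 t)).
have cG : {within `[0, T], continuous G}.
  move=> t; apply: continuousM; last exact: cD.
  exact: (continuous_subspaceT cE).
have dG1 x : x \in `]0, T[%R -> derivable G x 1.
  by rewrite in_itv /= => /dG[].
have dG2 x : x \in `]0, T[%R -> derive1 G x <= 0.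
  rewrite in_itv /= derive1E => xT; have [_ ->] := dG x xT.
  by rewrite pmulr_rle0 ?expR_gt0 // subr_le0 dDle.
have := ler0_derive1_le_cc dG1 dG2 cG (x := T) (y := 0).
rewrite !in_itv /= !lexx T0 => /(_ isT isT isT).
by rewrite /G !fctE D0 mulr0 pmulr_rle0 ?expR_gt0.
Qed.

End PlaneCalculus.

(** * Uniqueness of the point-vortex flow *)

Section Uniqueness.
Context {R : realType} {n : nat} (gam : 'I_n -> R) (z : 'I_n -> 'rV[R]_2).
Variables Z W : R -> 'I_n -> 'rV[R]_2.
Hypotheses (solZ : pv_solution gam z Z) (solW : pv_solution gam z W).

Let D t := \sum_(i < n) sqn (Z t i - W t i).
Let dD t := \sum_(i < n) 2 * dot (Z t i - W t i)
  (\sum_(j < n | j != i) gam j *: K (Z t i - Z t j) -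
   \sum_(j < n | j != i) gam j *: K (W t i - W t j)).
(** Gronwall coefficient: in each pair, the summand 1 comes from the Young inequality and the other
    one from the Lipschitz identity [sqn_KB]. *)
Let lip t := \sum_(i < n) \sum_(j < n | j != i)
  (1 + (gam j / pi) ^+ 2 / (sqn (Z t i - Z t j) * sqn (W t i - W t j))).

Let sub_sol_neq0 (Y : R -> 'I_n -> 'rV[R]_2) : pv_solution gam z Y ->
  forall (t : R) i j, 0 <= t -> i != j ->
  sqn (Y t i - Y t j) != 0.
Proof. by move=> [_ Y0 _ _] t i j t0 ij; rewrite sqn_eq0 subr_eq0 Y0. Qed.

Let dD_le (t : R) : 0 <= t -> dD t <= lip t * D t.
Proof.
move=> t0; rewrite /dD /lip mulr_suml; apply: ler_sum => i _.
have -> : \sum_(j < n | j != i) gam j *: K (Z t i - Z t j) -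
   \sum_(j < n | j != i) gam j *: K (W t i - W t j) =
   \sum_(j < n | j != i) gam j *: (K (Z t i - Z t j) - K (W t i - W t j)).
  by rewrite -sumrB; apply: eq_bigr => j _; rewrite scalerBr.
have -> : forall e (f : 'I_n -> 'rV[R]_2),
    2 * dot e (\sum_(j < n | j != i) f j) =
    \sum_(j < n | j != i) 2 * dot e (f j).
  move=> e f; rewrite /dot !summxE !mulr_sumr -big_split /= mulr_sumr //.
rewrite mulr_suml; apply: ler_sum => j ij.
have D_ge k : sqn (Z t k - W t k) <= D t.
  rewrite /D (bigD1 k) //= lerDl sumr_ge0 // => l _; exact: sqn_ge0.
apply: (le_trans (dot_young _ _)); rewrite mulrDl mul1r.
apply: lerD; first exact: D_ge.
have ji : i != j by rewrite eq_sym.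
have a0 := sub_sol_neq0 solZ t0 ji; have b0 := sub_sol_neq0 solW t0 ji.
have p0 : (pi : R) != 0 by rewrite gt_eqF // pi_gt0.
have -> : sqn (gam j *: (K (Z t i - Z t j) - K (W t i - W t j))) =
    gam j ^+ 2 * sqn (K (Z t i - Z t j) - K (W t i - W t j)).
  by rewrite /sqn !mxE; ring.
rewrite sqn_KB -?sqn_eq0 //.
have -> : Z t i - Z t j - (W t i - W t j) =
    (Z t i - W t i) - (Z t j - W t j).
  by apply/rowP => k; rewrite !mxE; ring.
set A := sqn (Z t i - Z t j) in a0 *; set B := sqn (W t i - W t j) in b0 *.
have A0 : 0 < A by rewrite lt_def a0 sqn_ge0.
have B0 : 0 < B by rewrite lt_def b0 sqn_ge0.
set S := sqn (_ - _ - _).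
(* The factor [1 / 4] is kept with [S], because [S] is at most [2 D + 2 D]. *)
have -> : gam j ^+ 2 * (S / (4 * pi ^+ 2 * A * B)) =
    (gam j / pi) ^+ 2 / (A * B) * (S / 4).
  by move: (pi : R) p0 => p p0; field; rewrite ?p0 ?a0 ?b0.
apply: ler_wpM2l; first by rewrite divr_ge0 ?sqr_ge0 // ltW ?mulr_gt0.
have := sqnB_le (Z t i - W t i) (Z t j - W t j); rewrite -/S.
by have := D_ge i; have := D_ge j; lra.
Qed.

Let sol_cvg (Y : R -> 'I_n -> 'rV[R]_2) (T t : R) :
  pv_solution gam z Y -> `[0, T]%classic t -> forall i,
  (fun s => Y s i) @ within `[0, T] (nbhs t) --> Y t i.
Proof.
move=> [_ _ cY _] tT i; move: t tT; apply/subspace_continuousP.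
apply: (continuous_subspaceW _ (cY i)) => s /=.
by rewrite !in_itv /= => /andP[-> _].
Qed.

Lemma pv_solution_unique (t : R) : 0 <= t -> Z t = W t.
Proof.
move=> t0.
have nn s : `[0, t]%classic s -> 0 <= s.
  by rewrite /= in_itv /= => /andP[].
have cvZW s (i : 'I_n) : `[0, t]%classic s ->
    (fun u => sqn (Z u i - W u i)) @ within `[0, t] (nbhs s) -->
    sqn (Z s i - W s i).
  by move=> st; apply: cvg_sqn; apply: cvgB; exact: sol_cvg.
have cvY Y s (i j : 'I_n) : pv_solution gam z Y -> `[0, t]%classic s ->
    (fun u => sqn (Y u i - Y u j)) @ within `[0, t] (nbhs s) -->
    sqn (Y s i - Y s j).
  by move=> solY st; apply: cvg_sqn; apply: cvgB; exact: sol_cvg.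
have cD : {within `[0, t], continuous D}.
  by apply/subspace_continuousP => s st; apply: cvg_bigsum => i _; exact: cvZW.
(* No pair collides in either solution, so [lip] is continuous on the compact interval and its
   maximum serves as Gronwall constant. *)
have cL : {within `[0, t], continuous lip}.
  apply/subspace_continuousP => s st; apply: cvg_bigsum => i _.
  apply: cvg_bigsum => j ij; apply: cvgD; first exact: cvg_cst.
  apply: cvgM; first exact: cvg_cst.
  rewrite eq_sym in ij; have s0 := nn s st.
  apply: cvgV; first by rewrite mulf_neq0 // sub_sol_neq0.
  by apply: cvgM; exact: cvY.
have [c ct lipc] := EVT_max t0 cL.
have Dt : D t <= 0.
  apply: (@gronwall0 _ D dD (lip c) t) => //.
  - move=> s /andP[s0 st]; apply: is_derive_bigsum => i _.
    apply: is_derive_sqn; apply: is_deriveB.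
      by case: solZ => _ _ _; apply.
    by case: solW => _ _ _; apply.
  - move=> s /andP[s0 st]; apply: (le_trans (dD_le (ltW s0))).
    apply: ler_wpM2r; first by apply: sumr_ge0 => i _; exact: sqn_ge0.
    by apply: lipc; rewrite in_itv /= !ltW.
  - rewrite /D big1 // => i _; case: solZ => -> _ _ _; case: solW => -> _ _ _.
    by apply/eqP; rewrite sqn_eq0 subrr.
apply/funext => i; apply/eqP; rewrite -subr_eq0 -sqn_eq0 eq_le sqn_ge0 andbT.
apply: le_trans Dt; rewrite /D (bigD1 i) //= lerDl sumr_ge0 // => l _.
exact: sqn_ge0.
Qed.

End Uniqueness.

(** * Rigid rotation of a relative equilibrium *)

Section RelativeEquilibrium.
Context {R : realType} {n : nat} (gam : 'I_n -> R) (z : 'I_n -> R[i]).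
Variable Om : R.
Hypothesis z_inj : injective z.
Hypothesis z_releq : forall i, (field_at gam z i)^~ = Om%:C * z i.
Hypothesis z_strain : forall i,
  \sum_(j < n | j != i) (gam j)%:C * (z i - z j)^-2 = 0.
Local Notation pc := (@plane_of_complex R).

Lemma expi0 : expi (0 : R) = 1.
Proof. by rewrite /expi cos0 sin0. Qed.

Lemma expiD (a b : R) : expi (a + b) = expi a * expi b.
Proof. by rewrite /expi cosD sinD; apply: complex_ext => //=; ring. Qed.

Lemma expi_conjM (a : R) : (expi a)^~ * expi a = 1.
Proof.
apply: complex_ext; rewrite /=; last by ring.
by rewrite -(cos2Dsin2 a); ring.
Qed.

Lemma expi_neq0 (a : R) : expi a != 0.
Proof.
by apply/eqP => e; have /eqP := expi_conjM a; rewrite e mulr0 eq_sym oner_eq0.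
Qed.

Lemma conj_inv_expi (a : R) : ((expi a)^-1)^~ = expi a.
Proof.
rewrite conjc_inv; apply: (mulfI (_ : (expi a)^~ != 0)).
  by rewrite conjc_eq0 expi_neq0.
by rewrite expi_conjM divff // conjc_eq0 expi_neq0.
Qed.

(** [K] carries the factor [1 / (2 pi)], hence the angular velocity [Om / (2 pi)]; the [+ 0] matches
    [is_derive_affine]. *)
Definition rotating (t : R) (i : 'I_n) : 'rV[R]_2 :=
  pc (expi (t * (Om / (2 * pi)) + 0) * z i).

Lemma is_derive_rotating (t : R) i :
  is_derive t (1 : R) (fun s => rotating s i)
    (pc (ci * (Om / (2 * pi))%:C * (expi (t * (Om / (2 * pi)) + 0) * z i))).
Proof.
set om := Om / _.
have dc := is_derive1_comp (is_derive_cos _) (is_derive_affine om 0 t).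
have ds := is_derive1_comp (is_derive_sin _) (is_derive_affine om 0 t).
apply: is_derive_row2; rewrite !mxE /=.
  have -> : (fun s => rotating s i 0 0) =
      Re (z i) *: (cos \o (fun s => s * om + 0))
      - Im (z i) *: (sin \o (fun s => s * om + 0)).
    apply/funext => s; rewrite /rotating mxE /= !fctE /= /GRing.scale /=.
    by case: (z i) => a b /=; ring.
  apply: (is_derive_eq (is_deriveB (is_deriveZ _ dc) (is_deriveZ _ ds))).
  by rewrite /GRing.scale /=; case: (z i) => a b /=; ring.
have -> : (fun s => rotating s i 0 1) =
    Im (z i) *: (cos \o (fun s => s * om + 0))
    + Re (z i) *: (sin \o (fun s => s * om + 0)).
  apply/funext => s; rewrite /rotating mxE /= !fctE /= /GRing.scale /=.
  by case: (z i) => a b /=; ring.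
apply: (is_derive_eq (is_deriveD (is_deriveZ _ dc) (is_deriveZ _ ds))).
by rewrite /GRing.scale /=; case: (z i) => a b /=; ring.
Qed.

Lemma rotatingB t i j : toC (rotating t i - rotating t j) =
  expi (t * (Om / (2 * pi)) + 0) * (z i - z j).
Proof. by rewrite toCB !pcK -mulrBr. Qed.

Lemma rotatingB_neq0 t i j : i != j -> rotating t i - rotating t j != 0.
Proof.
move=> ij; rewrite -toC_eq0 rotatingB mulf_neq0 ?expi_neq0 //.
exact: sub_neq0.
Qed.

Lemma toC_sum (I : Type) (r : seq I) (P : pred I) (c : I -> R)
    (f : I -> 'rV[R]_2) :
  toC (\sum_(i <- r | P i) c i *: f i) =
  \sum_(i <- r | P i) (c i)%:C * toC (f i).
Proof.
apply: complex_ext; rewrite ?Re_sum ?Im_sum /= summxE; apply: eq_bigr => i _;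
  by rewrite !mxE /=; ring.
Qed.

Lemma pv_solution_rotating : pv_solution gam (fun i => pc (z i)) rotating.
Proof.
split=> [i|t _ i j ij|i|t _ i].
- by rewrite /rotating mul0r addr0 expi0 mul1r.
- by rewrite -subr_eq0 rotatingB_neq0.
- apply: continuous_subspaceT => t; apply: differentiable_continuous.
  by apply/derivable1_diffP; case: (is_derive_rotating t i).
apply: (is_derive_eq (is_derive_rotating t i)).
rewrite -[RHS]toCK toC_sum; congr (pc _).
set E := expi _.
(* A rotation by [E] multiplies the velocity by the conjugate of [E^-1], which is [E] as [E] has
   modulus 1: the velocities turn with the configuration. *)
have -> : \sum_(j < n | j != i)
      (gam j)%:C * toC (K (rotating t i - rotating t j)) =
    ci * ((2 * pi)^-1)%:C * (E^-1)^~ * (field_at gam z i)^~.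
  rewrite conjc_sum mulr_sumr; apply: eq_bigr => j ij.
  by rewrite conjcZ toC_K rotatingB -/E [(E * _)^-1]invfM conjcM; ring.
rewrite z_releq conj_inv_expi -/E rmorphM /=; ring.
Qed.

(** By uniqueness every solution is the rigid rotation, along which the strain sum is multiplied by
    the inverse square of the rotation factor. *)
Lemma zero_strain_releq : zero_strain gam (fun i => pc (z i)).
Proof.
split; first by exists rotating; exact: pv_solution_rotating.
move=> Z solZ t t0 i.
rewrite (pv_solution_unique solZ pv_solution_rotating t0).
have -> : \sum_(j < n | j != i) gam j *: JK (rotating t i - rotating t j) =
    (2 * pi)^-1 *: \sum_(j < n | j != i) gam j *:
      strainmx ((expi (t * (Om / (2 * pi)) + 0) * (z i - z j))^-2).
  rewrite scaler_sumr; apply: eq_bigr => j ij.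
  rewrite JK_strainmx ?rotatingB ?scalerA 1?mulrC //.
  by rewrite rotatingB_neq0 // eq_sym.
rewrite -strainmx_sum (_ : \sum_(j < n | j != i) _ = 0) ?strainmx0 ?scaler0 //.
set E := expi _.
transitivity (E^-2 * \sum_(j < n | j != i) (gam j)%:C * (z i - z j)^-2).
  rewrite mulr_sumr; apply: eq_bigr => j ij.
  by rewrite exprMn invfM; ring.
by rewrite z_strain mulr0.
Qed.

End RelativeEquilibrium.

(** * Bases of S-invariant 2-planes *)

Section BlockBasis.
Context {R : realType} {d M : nat} (S : 'M[R]_d) (B : 'M[R]_(d, 2)).
Variables (x : 'I_M -> 'cV[R]_d) (b : 'I_M -> R).
Hypothesis rankB : row_free B^T.
Hypothesis dimM : (M * 2 + 2)%N = d.
Hypothesis xB : forall k, (x k)^T *m B = 0.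
Hypothesis SxB : forall k, (S *m x k)^T *m B = 0.
Hypothesis b_neq0 : forall k, b k != 0.
Hypothesis SSx : forall k, S *m (S *m x k) = - b k ^+ 2 *: x k.
Hypothesis x_free : forall al be : 'I_M -> R,
  \sum_(k < M) (al k *: x k + be k *: (S *m x k)) = 0 ->
  forall k, al k = 0 /\ be k = 0.

(** The columns are [b x] and [- S x]: [S] sends the first to [- b] times the second and the second
    to [b] times the first, which is the action of [antisym2 b]. *)
Let Q k : 'M[R]_(d, 2) :=
  (b k *: x k) *m delta_mx 0 0 - (S *m x k) *m delta_mx 0 1.

Let P : 'M[R]_(d, \sum_(k < M) 2) := \mxrow_(k < M) Q k.

Lemma delta0_antisym2 (c : R) :
  delta_mx (0 : 'I_1) 0 *m antisym2 c = c *: delta_mx 0 1.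
Proof. by apply: row2P; rewrite mulmx_row2 !mxE /=; ring. Qed.

Lemma delta1_antisym2 (c : R) :
  delta_mx (0 : 'I_1) 1 *m antisym2 c = - c *: delta_mx 0 0.
Proof. by apply: row2P; rewrite mulmx_row2 !mxE /=; ring. Qed.

Let S_P : S *m P = P *m \mxdiag_(k < M) antisym2 (b k).
Proof.
rewrite mul_mxrow mul_mxrow_mxdiag; apply: eq_mxrow => k.
rewrite /Q mulmxBr mulmxBl -!mulmxA delta0_antisym2 delta1_antisym2 !mulmxA.
rewrite -scalemxAr -[S *m S *m _]mulmxA SSx.
by rewrite -!scalemxAr -!scalemxAl scalerA !scaleNr !opprK addrC -expr2.
Qed.

Let P_coef (c : 'cV[R]_(\sum_(k < M) 2)) : P *m c =
  \sum_(k < M) (c (tagnat.Rank k 0) 0 * b k *: x k +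
                - c (tagnat.Rank k 1) 0 *: (S *m x k)).
Proof.
rewrite -[c in LHS]submxcolK mul_mxrow_mxcol; apply: eq_bigr => k _.
have dm (s : 'I_2) (A : 'cV[R]_2) : delta_mx (0 : 'I_1) s *m A = (A s 0)%:M.
  by rewrite -rowE; apply/matrixP => i j; rewrite !ord1 !mxE.
rewrite /Q mulmxBl -!mulmxA !dm !mul_mx_scalar !mxE scalerA.
by rewrite scaleNr scalemxAr.
Qed.

Let P_free : row_free P^T.
Proof.
apply: inj_row_free => v vP.
have := P_coef v^T; rewrite -[P *m _]trmxK trmx_mul trmxK vP trmx0.
move=> /esym/x_free vk; apply/rowP => p; rewrite mxE.
rewrite -[p]tagnat.sig2K; move: (tagnat.sig1 p) (tagnat.sig2 p) => k s.
have [] := vk k; rewrite !mxE => /eqP.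
rewrite mulf_eq0 (negbTE (b_neq0 _)) orbF => /eqP v0 /eqP.
rewrite oppr_eq0 => /eqP v1.
case: s => -[|[|//]] sp.
  by rewrite -[RHS]v0; congr (v 0 (tagnat.Rank k _)); exact/val_inj.
by rewrite -[RHS]v1; congr (v 0 (tagnat.Rank k _)); exact/val_inj.
Qed.

(** The annihilator of [B] has dimension [d - 2 = 2 M], so [2 M] independent columns inside it
    already span it. *)
Lemma block_basis : exists P : 'M[R]_(d, \sum_(k < M) 2),
  is_basis [set Y | Y^T *m B = 0] P /\
  S *m P = P *m \mxdiag_(k < M) antisym2 (b k).
Proof.
exists P; split=> //.
have PB : P^T *m B = 0.
  rewrite /P tr_mxrow mxcol_mul; rewrite -[RHS]mxcol0; apply: eq_mxcol => k.
  rewrite /Q linearB /= (trmx_mul (_ *: _)) (trmx_mul (S *m _)) mulmxBl.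
  rewrite -!mulmxA SxB linearZ /= -scalemxAl xB.
  by rewrite scaler0 !mulmx0 subrr.
split=> //.
- move=> j /=; rewrite tr_col -row_mul PB; exact: row0.
move=> Y /= YB.
have PK : (P^T <= kermx B)%MS by apply/sub_kermxP.
have /eqmxP eqK : (P^T == kermx B)%MS.
  rewrite -(geq_leqif (mxrank_leqif_eq PK)) mxrank_ker.
  have /eqP -> := P_free; have /eqP := rankB; rewrite mxrank_tr => ->.
  by rewrite sum_nat_const card_ord; lia.
have : (Y^T <= P^T)%MS by rewrite eqK; apply/sub_kermxP.
by case/submxP => D YD; exists D^T; rewrite -[LHS]trmxK YD trmx_mul trmxK.
Qed.

End BlockBasis.

(** * The regular polygon with a central vortex *)

Section Polygon.
Context {R : realType} {m n : nat} {zeta : R[i]}.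
Hypothesis m_ge3 : (3 <= m)%N.
Hypothesis n_range : (m <= n <= m.+1)%N.
Hypothesis prim_zeta : m.-primitive_root zeta.
Hypothesis zeta_unit : zeta^~ * zeta = 1.

(** The prescribed [(N - 2) (N - 6) / 12] in terms of [m = N - 1]. *)
Definition gcenter : R := (m%:R - 1) * (m%:R - 5) / 12.
Definition gam_ (k : nat) : R := if (k < m)%N then 1 else gcenter.
(** Defined on all naturals so that sums over ranges apply; index [m] is the center. *)
Definition pos_ (k : nat) : R[i] := if (k < m)%N then zeta ^+ k.+1 else 0.
Hypothesis gcenter0 : n = m -> gcenter = 0.

Definition mode k j : R[i] := zeta ^+ (k * j.+1).

Let m_gt0 : (0 < m)%N. Proof. by case: m m_ge3. Qed.

Let zeta_neq0 k : zeta ^+ k != 0. Proof. exact: (prim_neq0 prim_zeta). Qed.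

Lemma conj_pow k : (zeta ^+ k)^~ = (zeta ^+ k)^-1.
Proof.
apply: (mulIf (zeta_neq0 k)); rewrite mulVf // conjcX -exprMn zeta_unit.
by rewrite expr1n.
Qed.

Lemma modeM k l j : mode k j * mode l j = mode (k + l) j.
Proof. by rewrite /mode mulnDl exprD. Qed.

Lemma conj_mode k j : (k <= m)%N -> (mode k j)^~ = mode (m - k) j.
Proof.
move=> km; rewrite /mode conj_pow; apply: (mulfI (zeta_neq0 (k * j.+1))).
rewrite divff // -exprD -mulnDl subnKC // exprM.
by rewrite (prim_expr_order prim_zeta) expr1n.
Qed.

Lemma sum_mode k : \sum_(0 <= j < m) mode k j = (m * (m %| k))%:R.
Proof.
rewrite -(sum_prim prim_zeta) /mode.
rewrite (eq_big_nat _ _ (F2 := fun j => (zeta ^+ j.+1) ^+ k)); last first.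
  by move=> j _; rewrite mulnC exprM.
rewrite (sum_prim_shift prim_zeta (fun w => w ^+ k) 1).
by apply: eq_bigr => j _; rewrite mulnC exprM.
Qed.

Lemma sum_mode_eq0 k : (0 < k < m)%N -> \sum_(0 <= j < m) mode k j = 0.
Proof.
move=> /andP[k0 km]; rewrite sum_mode.
have /negbTE-> : ~~ (m %| k)%N by apply/negP => /(dvdn_leq k0); lia.
by rewrite muln0.
Qed.

(** When the center is absent [gcenter] is 0, so its term can be kept and one formula serves both
    [n = m] and [n = m.+1]. *)
Lemma weighted_sum (F : nat -> R[i]) (i : 'I_n) :
  \sum_(j < n | j != i) (gam_ j)%:C * F j =
  \sum_(0 <= j < m | j != i) F j +
  (if i == m :> nat then 0 else gcenter%:C * F m).
Proof.
transitivity (\sum_(0 <= j < n) if j != i then (gam_ j)%:C * F j else 0).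
  by rewrite big_mkcond big_mkord.
set k := nat_of_ord i; clearbody k; rewrite [in RHS]big_mkcond.
have E : \sum_(0 <= j < m) (if j != k then (gam_ j)%:C * F j else 0) =
    \sum_(0 <= j < m) if j != k then F j else 0.
  by apply: eq_big_nat => j jm; rewrite /gam_ (andP jm).2 mul1r.
have [nm|nm] : n = m \/ n = m.+1 by lia.
  by rewrite nm E gcenter0 // mul0r if_same addr0.
rewrite nm big_nat_recr //= E; congr (_ + _).
by rewrite (eq_sym k); case: eqVneq => //= _; rewrite /gam_ ltnn.
Qed.

(** * Relative equilibrium and zero strain of the polygon *)

Definition zcfg (i : 'I_n) : R[i] := pos_ i.
Definition gcfg (i : 'I_n) : R := gam_ i.

Lemma pos_ext i : (i < m)%N -> pos_ i = zeta ^+ i.+1.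
Proof. by rewrite /pos_ => ->. Qed.

Lemma pos_center : pos_ m = 0.
Proof. by rewrite /pos_ ltnn. Qed.

Lemma ord_case (i : 'I_n) : (i < m)%N \/ i = m :> nat.
Proof. by have := ltn_ord i; lia. Qed.

Lemma zcfg_inj : injective zcfg.
Proof.
move=> i j; rewrite /zcfg => e; apply/val_inj => /=; apply/eqP.
have [im|im] := ord_case i; have [jm|jm] := ord_case j.
- apply/negP => /negP ij; have := prim_expr_inj prim_zeta im jm ij.
  move: e; rewrite !pos_ext // !exprS => /(mulfI _) ->; rewrite ?subrr ?eqxx //.
  by rewrite -(expr1 zeta).
- move: e; rewrite jm pos_center pos_ext // => /eqP.
  by rewrite (negbTE (zeta_neq0 _)).
- move: e; rewrite im pos_center pos_ext // => /esym/eqP.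
  by rewrite (negbTE (zeta_neq0 _)).
by rewrite im jm.
Qed.

(** Angular velocity up to the factor [2 pi]: the polygon contributes [(m - 1) / 2] and the center
    [gcenter]. *)
Definition Omega : R := (m%:R ^+ 2 - 1) / 12.

Let natC k : (k%:R : R)%:C = k%:R. Proof. exact: rmorph_nat. Qed.

Lemma OmegaE : Omega%:C = (m%:R - 1) / 2 + gcenter%:C :> R[i].
Proof.
rewrite -[m%:R]natC -[2]natC -(rmorph1 (real_complex R)) -rmorphB -fmorphV.
by rewrite -rmorphM -rmorphD; congr (_%:C); rewrite /Omega /gcenter; field.
Qed.

Lemma sum_over_center (F : nat -> R[i]) :
  \sum_(0 <= j < m | j != m) F j = \sum_(0 <= j < m) F j.
Proof.
rewrite big_nat_cond [RHS]big_nat_cond; apply: eq_bigl => j.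
by case: ltngtP; rewrite ?andbF.
Qed.

Lemma eq_ext i (F G : nat -> R[i]) :
  (forall j, (j < m)%N -> j != i -> F j = G j) ->
  \sum_(0 <= j < m | j != i) F j = \sum_(0 <= j < m | j != i) G j.
Proof.
move=> FG; rewrite big_nat_cond [RHS]big_nat_cond.
by apply: eq_bigr => j /andP[/andP[_ jm] ji]; exact: FG.
Qed.

Lemma zcfg_releq i : (field_at gcfg zcfg i)^~ = Omega%:C * zcfg i.
Proof.
rewrite /field_at /zcfg /gcfg (weighted_sum (fun j => (pos_ i - pos_ j)^-1)).
have [im|im] := ord_case i; last first.
  rewrite im eqxx addr0 pos_center mulr0 sum_over_center.
  (* A root is the conjugate of its inverse, so at the center the conjugate field is minus the sum
     of the roots. *)
  transitivity (- \sum_(0 <= j < m) mode 1 j); last first.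
    by rewrite sum_mode_eq0 ?oppr0 //; lia.
  rewrite conjc_sum -sumrN; apply: eq_big_nat => j /andP[_ jm].
  rewrite pos_ext // sub0r invrN conjcN /mode mul1n conjc_inv conj_pow.
  by rewrite invrK.
rewrite (ltn_eqF im) pos_center subr0 pos_ext //.
rewrite (@eq_ext i _ (fun j => (zeta ^+ i.+1 - zeta ^+ j.+1)^-1)); last first.
  by move=> j jm _; rewrite pos_ext.
rewrite (sum_inv_sub prim_zeta im) -mulrDl -OmegaE conjcM conjc_real.
by rewrite conjc_inv conj_pow invrK.
Qed.

Lemma gcenterC : gcenter%:C = (m%:R - 1) * (m%:R - 5) / 12 :> R[i].
Proof.
rewrite /gcenter rmorphM fmorphV rmorphM !rmorphB rmorph1.
by rewrite -[m%:R in RHS]natC -[5 in RHS]natC -[12 in RHS]natC.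
Qed.

(** The inverse square of a root is its wave of frequency [m - 2], and [0 < m - 2 < m] because
    [m >= 3]. *)
Lemma sum_inv_sq : \sum_(0 <= j < m) (zeta ^+ j.+1)^-2 = 0.
Proof.
rewrite -[RHS](@sum_mode_eq0 (m - 2)); last lia.
apply: eq_big_nat => j _; rewrite -conj_mode; last lia.
by rewrite /mode mulnC exprM conjcX conj_pow exprVn.
Qed.

(** At an exterior vortex [w] the polygon contributes [inv2_sum 0 / w^2] and the center
    [gcenter / w^2]; [gcenter] is exactly the value that makes them cancel. *)
Lemma zcfg_strain i :
  \sum_(j < n | j != i) (gcfg j)%:C * (zcfg i - zcfg j)^-2 = 0.
Proof.
rewrite /zcfg /gcfg (weighted_sum (fun j => (pos_ i - pos_ j)^-2)).
have [im|im] := ord_case i; last first.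
  rewrite im eqxx addr0 pos_center sum_over_center -[RHS]sum_inv_sq.
  by apply: eq_big_nat => j /andP[_ jm]; rewrite pos_ext // sub0r sqrrN.
rewrite (ltn_eqF im) pos_center subr0 pos_ext //.
rewrite (@eq_ext i _ (fun j =>
  zeta ^+ (0 * j.+1) / (zeta ^+ i.+1 - zeta ^+ j.+1) ^+ 2)); last first.
  by move=> j jm _; rewrite pos_ext // mul0n mul1r.
rewrite (sum_mode_sub prim_zeta _ im) (inv2_sum0 prim_zeta) -gcenterC.
by rewrite mul0n expr0 mulr1 mulNr addNr.
Qed.

(* Dividing the perturbation of the exterior vortex w = zeta^(j+1) by w itself
   separates its radial part (real) from its tangential part (imaginary); the
   quotient is c w^k + d w^-k, and w0 is the perturbation of the center. *)
Definition pvec k (c d w0 : R[i]) (j : nat) : R[i] :=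
  if (j < m)%N then zeta ^+ j.+1 * (c * mode k j + d * mode (m - k) j) else w0.

Definition vec k c d w0 : 'I_n -> R[i] := fun i => pvec k c d w0 i.

Definition sig k : R := sigma R m k.

Lemma sigC k : (sig k)%:C = sigma (R[i]) m k.
Proof.
rewrite /sig /sigma rmorphB !(rmorphM, fmorphV, rmorphB, rmorphXn) rmorph1.
by rewrite !rmorph_nat expr2.
Qed.

Lemma sig_sub k : (k <= m)%N -> sig (m - k) = sig k.
Proof. by move=> km; rewrite /sig /sigma natrB //; ring. Qed.

Lemma conj_mode_sub k i : (i < m)%N -> (k <= m)%N ->
  (zeta ^+ (k.+1 * i.+1) / zeta ^+ i.+1 ^+ 2)^~ = zeta ^+ i.+1 * mode (m - k) i.
Proof.
move=> im km; rewrite conjcM conjc_inv conj_pow conjcX conj_pow -conj_mode //.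
rewrite /mode conj_pow mulSn exprD.
by field; rewrite !zeta_neq0.
Qed.

Lemma sum_modeJ k i : (i < m)%N -> (k <= m)%N ->
  (\sum_(0 <= j < m | j != i)
    zeta ^+ (k.+1 * j.+1) / (zeta ^+ i.+1 - zeta ^+ j.+1) ^+ 2)^~ =
  (sig k)%:C * (zeta ^+ i.+1 * mode (m - k) i).
Proof.
move=> im km; rewrite (sum_mode_sub prim_zeta _ im) (inv2_sumE prim_zeta) //.
by rewrite -sigC -mulrA conjcZ conj_mode_sub.
Qed.

(** Conjugation exchanges the frequencies [k] and [m - k], hence [c] and [d]; both carry the same
    [sig k]. *)
Lemma sum_pvec k c d w0 (i : 'I_n) : (i < m)%N -> (k <= m)%N ->
  (\sum_(j < n | j != i) (gcfg j)%:C *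
    (vec k c d w0 j / (zcfg i - zcfg j) ^+ 2))^~ =
  (sig k)%:C * (zeta ^+ i.+1 * (d^~ * mode k i + c^~ * mode (m - k) i)) +
  gcenter%:C * w0^~ * zeta ^+ i.+1 ^+ 2.
Proof.
move=> im km; rewrite /zcfg /gcfg /vec.
rewrite (weighted_sum (fun j => pvec k c d w0 j / (pos_ i - pos_ j) ^+ 2)).
rewrite (ltn_eqF im) pos_center subr0 pos_ext // {2}/pvec ltnn.
rewrite (@eq_ext i _ (fun j =>
  c * (zeta ^+ (k.+1 * j.+1) / (zeta ^+ i.+1 - zeta ^+ j.+1) ^+ 2) +
  d * (zeta ^+ ((m - k).+1 * j.+1) / (zeta ^+ i.+1 - zeta ^+ j.+1) ^+ 2)));
  last first.
  move=> j jm _; rewrite pos_ext // /pvec jm /mode !mulSn !exprD; ring.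
rewrite big_split -!mulr_sumr /= conjcD conjcD (conjcM c) (conjcM d).
rewrite !sum_modeJ ?leq_subr // sig_sub // subKn //.
rewrite conjcZ (conjcM w0) conjc_inv conjcX conj_pow exprVn invrK.
ring.
Qed.

(** A wave reaches the center only if [m] divides [m - k + 1] or [k + 1], that is for [k = 1] or
    [k = m - 1]. *)
Lemma sum_pvec_center k c d w0 (i : 'I_n) : i = m :> nat -> (k <= m)%N ->
  (\sum_(j < n | j != i) (gcfg j)%:C *
    (vec k c d w0 j / (zcfg i - zcfg j) ^+ 2))^~ =
  c^~ * \sum_(0 <= j < m) mode (m - k + 1) j +
  d^~ * \sum_(0 <= j < m) mode (k + 1) j.
Proof.
move=> im km; rewrite /zcfg /gcfg /vec.
rewrite (weighted_sum (fun j => pvec k c d w0 j / (pos_ i - pos_ j) ^+ 2)).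
rewrite im eqxx addr0 pos_center sum_over_center conjc_sum !mulr_sumr.
rewrite -big_split /=; apply: eq_big_nat => j /andP[_ jm].
rewrite pos_ext // sub0r sqrrN /pvec jm conjcM conjc_inv conjcX !conjcM conjcD.
rewrite !conjcM !conj_mode ?leq_subr // subKn // conj_pow -!modeM.
by rewrite /mode !mul1n; field; rewrite !zeta_neq0.
Qed.

(** * The linearized operator on waves *)

Definition nu : R := - Omega.
Local Notation T := (lin_op gcfg zcfg nu).

Lemma vec_ext k c d w0 (i : 'I_n) : (i < m)%N ->
  vec k c d w0 i = zeta ^+ i.+1 * (c * mode k i + d * mode (m - k) i).
Proof. by rewrite /vec /pvec => ->. Qed.

Lemma vec_center k c d w0 (i : 'I_n) : i = m :> nat -> vec k c d w0 i = w0.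
Proof. by rewrite /vec /pvec => ->; rewrite ltnn. Qed.

Lemma lin_op_vec k c d : (0 < k < m)%N ->
  n = m \/ (k != 1 /\ k != m.-1)%N ->
  T (vec k c d 0) = vec k (ci * ((sig k)%:C * d^~ + nu%:C * c))
    (ci * ((sig k)%:C * c^~ + nu%:C * d)) 0.
Proof.
move=> km nk; apply/funext => i; rewrite /lin_op.
have [im|im] := ord_case i.
  rewrite sum_pvec //; last lia.
  by rewrite !vec_ext // conjc0 mulr0 mul0r addr0; ring.
rewrite sum_pvec_center //; last lia.
rewrite !vec_center // !sum_mode_eq0; try by have := ltn_ord i; lia.
by rewrite !mulr0 addr0 addr0 mulr0.
Qed.

Lemma mode1 j : mode 1 j = zeta ^+ j.+1.
Proof. by rewrite /mode mul1n. Qed.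

Lemma sig1 : sig 1 = - gcenter.
Proof. by rewrite /sig /sigma /gcenter; field. Qed.

Lemma lin_op_vec1 c d w0 :
  T (vec 1 c d w0) = vec 1 (ci * (gcenter%:C * (w0^~ - d^~) + nu%:C * c))
    (ci * (- gcenter%:C * c^~ + nu%:C * d))
    (ci * ((m%:R)%:C * c^~ + nu%:C * w0)).
Proof.
apply/funext => i; rewrite /lin_op.
have [im|im] := ord_case i.
  rewrite sum_pvec //.
  by rewrite !vec_ext // sig1 rmorphN mode1; ring.
(* The center sees [c], whose frequencies add up to [m], but not [d], whose frequency 2 is no
   multiple of [m]. *)
rewrite sum_pvec_center //.
have S2 : \sum_(0 <= j < m) mode (1 + 1) j = 0.
  by apply: sum_mode_eq0; lia.
rewrite !vec_center // subnK // S2 mulr0 addr0 sum_mode dvdnn muln1.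
by rewrite natC [_ * m%:R]mulrC.
Qed.

(* [hart k] is the real wave cos + sin of frequency k (Hartley basis); the
   waves are orthogonal because cc^2 + conj cc^2 = 0. *)
Definition cc : R[i] := Complex (2^-1) (- 2^-1).

Definition hart k j := cc * mode k j + cc^~ * mode (m - k) j.

Lemma cc_sq : cc ^+ 2 + cc^~ ^+ 2 = 0.
Proof. by apply: complex_ext; rewrite /=; field. Qed.

Lemma cc_norm : 2 * (cc * cc^~) = 1.
Proof. by apply: complex_ext; rewrite /=; field. Qed.

Lemma sum_modeM k l : \sum_(0 <= j < m) mode k j * mode l j =
  (m * (m %| k + l))%:R.
Proof. by under eq_bigr do rewrite modeM; rewrite sum_mode. Qed.

(** All four sums lie strictly between 0 and [2 m], where [m] is the only multiple of [m]. *)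
Lemma dvdm_add k l : (0 < k < m)%N -> (0 < l < m)%N ->
  [/\ (m %| k + l)%N = (k + l == m)%N, (m %| k + (m - l))%N = (k == l),
      (m %| (m - k) + l)%N = (k == l) &
      (m %| (m - k) + (m - l))%N = (k + l == m)%N].
Proof.
have dv a : (0 < a < m.*2)%N -> (m %| a)%N = (a == m).
  move=> am; apply/idP/eqP => [/dvdnP[q aq]|->]; last exact: dvdnn.
  have : (0 < q)%N by rewrite lt0n; apply/eqP => q0; move: am; rewrite aq q0.
  have : (q < 2)%N by rewrite -(ltn_pmul2r m_gt0) -aq; lia.
  by rewrite aq; case: q {aq} => [|[|//]] //; rewrite mul1n.
by move=> km lm; split; rewrite dv; lia.
Qed.

Lemma sum_mode_hart k l c d : (0 < k < m)%N -> (0 < l < m)%N ->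
  \sum_(0 <= j < m) (c * mode k j + d * mode (m - k) j) * hart l j =
  m%:R * ((k + l == m)%N%:R * (c * cc + d * cc^~) +
    (k == l)%:R * (c * cc^~ + d * cc)).
Proof.
move=> km lm; have [e1 e2 e3 e4] := dvdm_add km lm.
transitivity (\sum_(0 <= j < m) (
    c * cc * (mode k j * mode l j) + c * cc^~ * (mode k j * mode (m - l) j) +
    (d * cc * (mode (m - k) j * mode l j) +
     d * cc^~ * (mode (m - k) j * mode (m - l) j)))).
  by apply: eq_bigr => j _; rewrite /hart; ring.
rewrite !big_split -!mulr_sumr /= !sum_modeM e1 e2 e3 e4 !natrM.
by ring.
Qed.

Lemma hart_orth k l : (0 < k < m)%N -> (0 < l < m)%N ->
  \sum_(0 <= j < m) hart k j * hart l j = m%:R * (k == l)%:R.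
Proof.
move=> km lm; rewrite sum_mode_hart // -expr2 -expr2 cc_sq mulr0 add0r.
have -> : cc * cc^~ + cc^~ * cc = 1 by rewrite -[RHS]cc_norm; ring.
by rewrite mulr1.
Qed.

(** Pairing with [hart (f l)] isolates one coefficient; [r] collects what is orthogonal to that
    wave, such as the frequencies coupled to the center. *)
Lemma hart_coef (I : finType) (P : pred I) (f : I -> nat) (lam : I -> R[i])
    (r : nat -> R[i]) :
  (forall i, P i -> (0 < f i < m)%N) ->
  (forall i l, P i -> P l -> f i = f l -> i = l) ->
  (forall j, (j < m)%N ->
    \sum_(i | P i) lam i * hart (f i) j + r j = 0) ->
  forall l, P l -> \sum_(0 <= j < m) r j * hart (f l) j = 0 -> lam l = 0.
Proof.
move=> fm f_inj lr l Pl rl.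
have : \sum_(0 <= j < m)
    (\sum_(i | P i) lam i * hart (f i) j + r j) * hart (f l) j = 0.
  by rewrite big_nat big1 // => j jm; rewrite lr ?mul0r //; lia.
under eq_bigr do rewrite mulrDl mulr_suml.
rewrite big_split /= rl addr0 exchange_big /= (bigD1 l) //=.
rewrite [X in _ + X]big1 ?addr0; last first.
  move=> i /andP[Pi il]; under eq_bigr do rewrite -mulrA.
  rewrite -mulr_sumr hart_orth ?fm // (_ : (_ == _) = false) ?mulr0 //.
  by apply/negbTE; apply: contra il => /eqP/f_inj ->.
under eq_bigr do rewrite -mulrA.
rewrite -mulr_sumr hart_orth ?fm // eqxx mulr1.
by move=> /eqP; rewrite mulf_eq0 pnatr_eq0 (gtn_eqF m_gt0) orbF => /eqP.
Qed.

Lemma real_coefs (al be mu : R) : mu != 0 ->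
  al%:C + be%:C * (mu%:C * ci) = 0 -> al = 0 /\ be = 0.
Proof.
move=> mu0 /eqP; rewrite eq_complex /= => /andP[/eqP e1 /eqP e2].
split; first by rewrite -[RHS]e1; ring.
by apply: (mulIf mu0); rewrite mul0r -[RHS]e2; ring.
Qed.

(** Together the bounds say [|sig k| < - nu], which makes [S^2] negative on the wave. *)
Lemma sig_bounds k : (0 < k < m)%N -> nu < sig k /\ nu + sig k < 0.
Proof.
move=> /andP[k0 km]; rewrite /sig /sigma /nu /Omega.
have k0' : 0 < (k%:R : R) by rewrite ltr0n.
have km' : (k%:R : R) < m%:R by rewrite ltr_nat.
have m3 : 3 <= (m%:R : R) by rewrite (ler_nat _ 3).
have km0 : 0 < (k%:R : R) * (m%:R - k%:R) by rewrite mulr_gt0 ?subr_gt0.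
split; first by lra.
(* This square gives [k (m - k) <= m^2 / 4]; then [m >= 3] makes the second bound strict. *)
have := sqr_ge0 (m%:R - 2 * k%:R : R).
by nra.
Qed.

Definition freq k : R := Num.sqrt (nu ^+ 2 - sig k ^+ 2).

Lemma freq_sq k : (0 < k < m)%N -> freq k ^+ 2 = nu ^+ 2 - sig k ^+ 2.
Proof.
move=> km; rewrite sqr_sqrtr //; have [h1 h2] := sig_bounds km.
by rewrite subr_sqr; nra.
Qed.

Lemma freq_neq0 k : (0 < k < m)%N -> freq k != 0.
Proof.
move=> km; rewrite -sqrf_eq0 freq_sq //; have [h1 h2] := sig_bounds km.
by rewrite subr_sqr mulf_neq0 // ?subr_eq0; [rewrite lt_eqF | rewrite lt_eqF].
Qed.

(** * Invariant planes inside the complement of [V] *)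

Hypothesis gcenter_neq0 : n = m.+1 -> gcenter != 0.

Let gcfg_neq0 i : gcfg i != 0.
Proof.
rewrite /gcfg /gam_; case: ifP => im; first exact: oner_neq0.
by apply: gcenter_neq0; have := ltn_ord i; lia.
Qed.

Local Notation S := (Smx gcfg (cfg zcfg) nu).

Lemma S_cfg y : S *m cfg y = cfg (T y).
Proof. exact: (Smx_cfg zcfg_inj gcfg_neq0 zcfg_strain). Qed.

Lemma sum_all (F : nat -> R[i]) : \sum_(j < n) (gam_ j)%:C * F j =
  \sum_(0 <= j < m) F j + gcenter%:C * F m.
Proof.
have E : \sum_(0 <= j < m) (gam_ j)%:C * F j = \sum_(0 <= j < m) F j.
  by apply: eq_big_nat => j jm; rewrite /gam_ (andP jm).2 mul1r.
rewrite -(big_mkord xpredT (fun j => (gam_ j)%:C * F j)).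
have [nm|nm] : n = m \/ n = m.+1 by lia.
  by rewrite nm E gcenter0 // mul0r addr0.
by rewrite nm big_nat_recr //= E /gam_ ltnn.
Qed.

(** With columns [Gamma Z] and [Gamma J Z], the complement of [V] becomes the annihilator required
    by [block_basis]. *)
Definition Bperp : 'M[R]_(\sum_(i < n) 2, 2) :=
  (Gammamx gcfg *m cfg zcfg) *m delta_mx 0 0 +
  (Gammamx gcfg *m (Jmx R n *m cfg zcfg)) *m delta_mx 0 1.

Lemma BperpP (Y : 'cV[R]_(\sum_(i < n) 2)) : Y^T *m Bperp = 0 <->
  Y^T *m (Gammamx gcfg *m cfg zcfg) = 0 /\
  Y^T *m (Gammamx gcfg *m (Jmx R n *m cfg zcfg)) = 0.
Proof.
rewrite /Bperp mulmxDr !(mulmxA Y^T).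
set A0 := Y^T *m _ *m cfg zcfg; set A1 := Y^T *m _ *m (_ *m _).
rewrite -/A0 -/A1; move: A0 A1 => A0 A1.
split=> [|[-> ->]]; last by rewrite !mul0mx addr0.
rewrite [A0]mx11_scalar [A1]mx11_scalar !mul_scalar_mx => e.
have e0 := congr1 (fun M : 'rV[R]_2 => M 0 0) e.
have e1 := congr1 (fun M : 'rV[R]_2 => M 0 1) e.
move: e0 e1; rewrite !mxE /= !mulr1 !mulr0 ?addr0 ?add0r => -> ->.
by rewrite raddf0.
Qed.

Lemma Vperp_Bperp : Vperp gcfg (cfg zcfg) = [set Y | Y^T *m Bperp = 0].
Proof.
apply/seteqP; split=> Y /=.
  move=> YV; apply/BperpP; split; rewrite mulmxA; apply: YV.
    by exists 1, 0; rewrite scale1r scale0r addr0.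
  by exists 0, 1; rewrite scale1r scale0r add0r.
move=> /BperpP[Y0 Y1] X [a [b ->]].
by rewrite mulmxDr -!scalemxAr -!mulmxA Y0 Y1 !scaler0 addr0.
Qed.

Lemma Bperp_free : row_free Bperp^T.
Proof.
apply: inj_row_free => v vB.
have := congr1 trmx vB; rewrite trmx_mul trmxK trmx0 /Bperp mulmxDl -!mulmxA.
have dm (s : 'I_2) : delta_mx (0 : 'I_1) s *m v^T = (v 0 s)%:M.
  by rewrite -rowE; apply/matrixP => i j; rewrite !ord1 !mxE.
rewrite !dm !mul_mx_scalar -!scalemxAr Jmx_cfg !Gammamx_cfg !cfgZ cfgD -cfg0.
move=> /cfg_inj e; have n0 : (0 < n)%N by lia.
have := congr1 (@^~ (Ordinal n0)) e; rewrite /zcfg /gcfg /gam_ /= m_gt0.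
rewrite !mul1r mulrA -mulrDl => /eqP; rewrite mulf_eq0 pos_ext //.
rewrite (negbTE (zeta_neq0 _)) orbF eq_complex /= => /andP[/eqP h0 /eqP h1].
apply: row2P; rewrite mxE.
  by rewrite -[RHS]h0; ring.
by rewrite -[RHS]h1; ring.
Qed.

(** The real part of the complex sum is the pairing with [Gamma Z], its imaginary part minus the
    pairing with [Gamma J Z]. *)
Lemma cfg_Bperp y : \sum_(i < n) (gcfg i)%:C * ((y i)^~ * zcfg i) = 0 ->
  (cfg y)^T *m Bperp = 0.
Proof.
move=> e; apply/BperpP; rewrite Jmx_cfg !Gammamx_cfg.
split; rewrite [LHS]mx11_scalar pairing cfgK.
  under eq_bigr do rewrite rdotZr rdot_conjM.
  have /(congr1 (@complex.Re R)) := e; rewrite Re_sum /= => eR.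
  rewrite (_ : \sum_i _ = 0) ?raddf0 // -[RHS]eR; apply: eq_bigr => i _.
  by case: (y i) => a b; case: (zcfg i) => c d /=; ring.
under eq_bigr do rewrite rdotZr rdot_conjM.
have /(congr1 (@complex.Im R)) := e; rewrite Im_sum /= => eI.
rewrite (_ : \sum_i _ = 0) ?raddf0 //; apply/eqP; rewrite -oppr_eq0 -sumrN.
apply/eqP; rewrite -[RHS]eI; apply: eq_bigr => i _.
by case: (y i) => a b; case: (zcfg i) => c d /=; ring.
Qed.

(** The roots have modulus 1, so the exterior terms reduce to waves of frequencies [k] and [m - k],
    which sum to 0; the center sits at the origin. *)
Lemma vec_Bperp k c d w0 : (0 < k < m)%N -> (cfg (vec k c d w0))^T *m Bperp = 0.
Proof.
move=> km; apply: cfg_Bperp; rewrite /vec /zcfg /gcfg.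
rewrite (sum_all (fun i => (pvec k c d w0 i)^~ * pos_ i)) pos_center !mulr0.
rewrite addr0.
transitivity (\sum_(0 <= j < m) (c^~ * mode (m - k) j + d^~ * mode k j)).
  apply: eq_big_nat => j /andP[_ jm]; rewrite /pvec jm pos_ext //.
  rewrite conjcM conj_pow conjcD !conjcM !conj_mode ?leq_subr //; try lia.
  by rewrite subKn; [field; rewrite zeta_neq0 | lia].
by rewrite big_split -!mulr_sumr /= !sum_mode_eq0 ?mulr0 ?addr0 //; lia.
Qed.

Lemma cfg_sum (I : Type) (r : seq I) (P : pred I) (f : I -> 'I_n -> R[i]) :
  \sum_(k <- r | P k) cfg (f k) = cfg (fun i => \sum_(k <- r | P k) f k i).
Proof.
elim: r => [|k r IHr].
  by rewrite big_nil -cfg0; apply: eq_cfg => i; rewrite big_nil.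
rewrite big_cons IHr; case: ifP => Pk; [rewrite cfgD|];
  by apply: eq_cfg => i; rewrite big_cons Pk.
Qed.

Lemma scale_vec k c d w0 (s : R) :
  s *: cfg (vec k c d w0) = cfg (vec k (s%:C * c) (s%:C * d) (s%:C * w0)).
Proof.
rewrite cfgZ; apply: eq_cfg => i; rewrite /vec /pvec.
by case: ifP => _ //; ring.
Qed.

Definition hartvec k := vec k cc cc^~ 0.
Definition mu k : R := nu + sig k.

Lemma muC k : (mu k)%:C = nu%:C + (sig k)%:C :> R[i].
Proof. exact: rmorphD. Qed.

(** [hart k] is real, so the perturbation is radial and [S] turns it into the tangential one with
    factor [mu k * ci]. *)
Lemma lin_op_hart k : (0 < k < m)%N -> n = m \/ (k != 1 /\ k != m.-1)%N ->
  T (hartvec k) = vec k ((mu k)%:C * ci * cc) ((mu k)%:C * ci * cc^~) 0.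
Proof.
move=> km nk; rewrite /hartvec lin_op_vec // conjcK muC.
by congr (vec _ _ _ _); ring.
Qed.

(** On the tangential wave conjugation reverses the sign of [sig k], so the two applications give
    [- (nu + sig k) (nu - sig k)]. *)
Lemma SS_hart k : (0 < k < m)%N -> n = m \/ (k != 1 /\ k != m.-1)%N ->
  S *m (S *m cfg (hartvec k)) = - freq k ^+ 2 *: cfg (hartvec k).
Proof.
move=> km nk; rewrite !S_cfg lin_op_hart // lin_op_vec // scale_vec.
rewrite freq_sq // mulr0 /mu; apply: eq_cfg => i; congr (vec _ _ _ _ i).
  rewrite !conjcM conjcK !conjc_real.
  by apply: complex_ext; rewrite /=; ring.
rewrite !conjcM !conjc_real.
by apply: complex_ext; rewrite /=; ring.
Qed.

(** [n - 1] independent planes fill the complement of [V], of dimension [2 n - 2]; this restates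
    [block_basis] in complex coordinates. *)
Lemma stable_of_blocks M (x : 'I_M -> 'I_n -> R[i]) (b : 'I_M -> R) :
  (M.+1 = n)%N ->
  (forall k, (cfg (x k))^T *m Bperp = 0) ->
  (forall k, (cfg (T (x k)))^T *m Bperp = 0) ->
  (forall k, b k != 0) ->
  (forall k, S *m (S *m cfg (x k)) = - b k ^+ 2 *: cfg (x k)) ->
  (forall al be : 'I_M -> R,
    (forall i, \sum_(k < M) ((al k)%:C * x k i + (be k)%:C * T (x k) i) = 0) ->
    forall k, al k = 0 /\ be k = 0) ->
  exists (M : nat) (b : 'I_M -> R)
    (P : 'M[R]_(\sum_(i < n) 2, \sum_(k < M) 2)),
    is_basis (Vperp gcfg (cfg zcfg)) P /\
    S *m P = P *m \mxdiag_(k < M) antisym2 (b k).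
Proof.
move=> Mn xB TxB b0 SSx x_free.
have dimM : (M * 2 + 2 = \sum_(i < n) 2)%N.
  by rewrite sum_nat_const card_ord -Mn; lia.
have SxB k : (S *m cfg (x k))^T *m Bperp = 0 by rewrite S_cfg.
have Sx_free (al be : 'I_M -> R) :
    \sum_(k < M) (al k *: cfg (x k) + be k *: (S *m cfg (x k))) = 0 ->
    forall k, al k = 0 /\ be k = 0.
  have E k : al k *: cfg (x k) + be k *: (S *m cfg (x k)) =
      cfg (fun i => (al k)%:C * x k i + (be k)%:C * T (x k) i).
    by rewrite S_cfg !cfgZ cfgD.
  rewrite (eq_bigr _ (fun k _ => E k)) cfg_sum -cfg0 => /cfg_inj e.
  by apply: x_free => i; have := congr1 (@^~ i) e.
have [P [PB SP]] := block_basis Bperp_free dimM xB SxB b0 SSx Sx_free.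
by exists M, b, P; rewrite Vperp_Bperp.
Qed.
Let block_bases := exists (M : nat) (b : 'I_M -> R)
  (P : 'M[R]_(\sum_(i < n) 2, \sum_(k < M) 2)),
  is_basis (Vperp gcfg (cfg zcfg)) P /\
  S *m P = P *m \mxdiag_(k < M) antisym2 (b k).

Lemma hartvec_coef (al be : R) k (i : 'I_n) : (i < m)%N -> (0 < k < m)%N ->
  n = m \/ (k != 1 /\ k != m.-1)%N ->
  al%:C * hartvec k i + be%:C * T (hartvec k) i =
  zeta ^+ i.+1 * ((al%:C + be%:C * ((mu k)%:C * ci)) * hart k i).
Proof.
by move=> im km nk; rewrite lin_op_hart // /hartvec !vec_ext // /hart; ring.
Qed.

Lemma mu_neq0 k : (0 < k < m)%N -> mu k != 0.
Proof. by move=> /sig_bounds[_ h]; rewrite /mu lt_eqF. Qed.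

(** * Bases without and with a central vortex *)

Lemma block_bases_no_center : n = m -> block_bases.
Proof.
(* The frequencies are [1] to [m - 1], hence the shift [k.+1]; frequency 0 spans [V]. *)
move=> nm; pose M := m.-1.
have km (k : 'I_M) : (0 < k.+1 < m)%N by have := ltn_ord k; rewrite /M; lia.
have nk (k : 'I_M) : n = m \/ (k.+1 != 1 /\ k.+1 != m.-1)%N by left.
apply: (@stable_of_blocks M (fun k => hartvec k.+1) (fun k => freq k.+1)).
- by rewrite /M prednK.
- by move=> k; exact: vec_Bperp.
- by move=> k; rewrite lin_op_hart //; exact: vec_Bperp.
- by move=> k; exact: freq_neq0.
- by move=> k; exact: SS_hart.
move=> al be e k.
apply: (real_coefs (mu_neq0 (km k))).
(* [S] multiplies a radial wave by an imaginary number, so two real coefficients form one complex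
   coefficient of [hart], isolated by orthogonality. *)
pose lam (k : 'I_M) : R[i] := (al k)%:C + (be k)%:C * ((mu k.+1)%:C * ci).
apply: (@hart_coef _ xpredT (fun k : 'I_M => k.+1) lam (fun=> 0)) => //.
- by move=> i l _ _ /succn_inj/val_inj.
- move=> j jm; have jn : (j < n)%N by rewrite nm.
  apply: (mulfI (zeta_neq0 j.+1)); rewrite addr0 mulr0 mulr_sumr.
  rewrite -[RHS](e (Ordinal jn)); apply: eq_bigr => l _.
  by rewrite hartvec_coef.
by rewrite big1 // => j _; rewrite mul0r.
Qed.

(* The waves of frequency 1 and m - 1 interact with the center. They and the
   center are replaced by a translation (index 0) and by two vectors which span,
   together with their images under S, the perturbations of these frequencies
   that do not move the center of vorticity. *)
Definition cvec k : 'I_n -> R[i] :=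
  if k == 0%N then vec 1 0 1 1
  else if k == 1%N then vec 1 1 0 0
  else if k == m.-1 then vec 1 ci 0 0
  else hartvec k.

Definition cfreq k : R :=
  if k == 0%N then nu
  else if (k == 1%N) || (k == m.-1) then Num.sqrt ((m%:R ^+ 2 - 1) / 6)
  else freq k.

Let m_real_ge3 : 3 <= (m%:R : R).
Proof. by rewrite (ler_nat _ 3). Qed.

Lemma nu_neq0 : nu != 0.
Proof. by rewrite /nu /Omega lt_eqF //; have := m_real_ge3; nra. Qed.

(** With [- nu = (m - 1) / 2 + gcenter] the squares of [gcenter] cancel, leaving
    [(m - 1)^2 / 4 - gcenter]. *)
Lemma cfreq_sq : Num.sqrt ((m%:R ^+ 2 - 1) / 6) ^+ 2 =
  nu ^+ 2 - gcenter * (m%:R + gcenter) :> R.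
Proof.
rewrite sqr_sqrtr; last by have := m_real_ge3; nra.
by rewrite /nu /Omega /gcenter; field.
Qed.

Lemma cfreq_neq0 k : (k < m)%N -> cfreq k != 0.
Proof.
move=> km; rewrite /cfreq; case: (k =P 0%N) => [_|k0]; first exact: nu_neq0.
case: ifP => _; last by apply: freq_neq0; lia.
by rewrite gt_eqF // sqrtr_gt0; have := m_real_ge3; nra.
Qed.

(** The coefficient [d = 1] is a constant displacement, since a root times its wave of frequency
    [m - 1] is 1; translations are merely rotated by [nu]. *)
Lemma lin_op_cvec0 : T (cvec 0) = vec 1 0 (nu%:C * ci) (nu%:C * ci).
Proof.
rewrite /cvec /= lin_op_vec1; congr (vec _ _ _ _);
  by rewrite ?conjc0 ?conjc1; apply: complex_ext; rewrite /=; ring.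
Qed.

Lemma lin_op_cvec1 :
  T (cvec 1) = vec 1 (nu%:C * ci) (- gcenter%:C * ci) ((m%:R)%:C * ci).
Proof.
rewrite /cvec /= lin_op_vec1; congr (vec _ _ _ _);
  by rewrite ?conjc0 ?conjc1; apply: complex_ext; rewrite /=; ring.
Qed.

Lemma lin_op_cvecm : T (cvec m.-1) = vec 1 (- nu%:C) (- gcenter%:C) (m%:R)%:C.
Proof.
rewrite /cvec eqxx; have /negbTE-> : (m.-1 != 0)%N by lia.
have /negbTE-> : (m.-1 != 1)%N by lia.
rewrite lin_op_vec1; congr (vec _ _ _ _);
  by rewrite ?conjc0 ?conjc1; apply: complex_ext; rewrite /=; ring.
Qed.

Lemma cvec_hart k : (1 < k < m.-1)%N -> cvec k = hartvec k.
Proof.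
move=> km; rewrite /cvec.
by do 3![rewrite (_ : (k == _) = false); last by apply/negbTE; lia].
Qed.

Lemma cvec_case k : (k < m)%N ->
  [\/ k = 0%N, k = 1%N, k = m.-1 | (1 < k < m.-1)%N].
Proof.
move=> km; have [->|k0] := eqVneq k 0%N; first by constructor 1.
have [->|k1] := eqVneq k 1%N; first by constructor 2.
have [->|k2] := eqVneq k m.-1; first by constructor 3.
by constructor 4; lia.
Qed.

Lemma hart_side k : (1 < k < m.-1)%N ->
  (0 < k < m)%N /\ (n = m \/ (k != 1 /\ k != m.-1)%N).
Proof. by move=> km; split; [lia | right; lia]. Qed.

Lemma SS_cvec k : (k < m)%N ->
  S *m (S *m cfg (cvec k)) = - cfreq k ^+ 2 *: cfg (cvec k).
Proof.
move=> km; case: (cvec_case km) => [->|->|->|kc].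
- rewrite !S_cfg lin_op_cvec0 lin_op_vec1 /cfreq /cvec /= scale_vec.
  apply: eq_cfg => i; congr (vec _ _ _ _ i);
  by rewrite ?conjc0 ?conjc1; apply: complex_ext; rewrite /=; ring.
- rewrite !S_cfg lin_op_cvec1 lin_op_vec1 /cfreq /cvec /= scale_vec cfreq_sq.
  apply: eq_cfg => i; congr (vec _ _ _ _ i);
  by rewrite ?conjc0 ?conjc1; apply: complex_ext; rewrite /=; ring.
- rewrite !S_cfg lin_op_cvecm lin_op_vec1 /cfreq /cvec eqxx orbT.
  have /negbTE-> : (m.-1 != 0)%N by lia.
  have /negbTE-> : (m.-1 != 1)%N by lia.
  rewrite scale_vec cfreq_sq; apply: eq_cfg => i.
  congr (vec _ _ _ _ i);
  by rewrite ?conjc0 ?conjc1; apply: complex_ext; rewrite /=; ring.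
have [h1 h2] := hart_side kc.
rewrite cvec_hart // /cfreq; have /negbTE-> : (k != 0)%N by lia.
have /negbTE-> : ~~ ((k == 1%N) || (k == m.-1)) by lia.
exact: SS_hart.
Qed.

(** Six real unknowns are gathered into three complex coefficients, two for the exterior waves and
    one for the center. *)
Lemma cvec_special (al0 al1 al2 be0 be1 be2 : R) (i : 'I_n) :
  al0%:C * cvec 0 i + be0%:C * T (cvec 0) i +
  (al1%:C * cvec 1 i + be1%:C * T (cvec 1) i) +
  (al2%:C * cvec m.-1 i + be2%:C * T (cvec m.-1) i) =
  vec 1 (al1%:C + al2%:C * ci + nu%:C * (be1%:C * ci - be2%:C))
    (al0%:C + be0%:C * (nu%:C * ci) - gcenter%:C * (be1%:C * ci + be2%:C))
    (al0%:C + be0%:C * (nu%:C * ci) + (m%:R)%:C * (be1%:C * ci + be2%:C)) i.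
Proof.
rewrite lin_op_cvec0 lin_op_cvec1 lin_op_cvecm /cvec eqxx /=.
have /negbTE-> : (m.-1 != 0)%N by lia.
have /negbTE-> : (m.-1 != 1)%N by lia.
by rewrite /vec /pvec; case: ifP => _; ring.
Qed.

(** Pairing with [mode m.-1] isolates [U] and pairing with [mode 1] isolates [D], as neither [2] nor
    [2 (m - 1)] is a multiple of [m]. *)
Lemma mode_pair_free (U D : R[i]) :
  (forall j, (j < m)%N -> U * mode 1 j + D * mode m.-1 j = 0) ->
  U = 0 /\ D = 0.
Proof.
move=> UD; have m0 : (m%:R : R[i]) != 0 by rewrite pnatr_eq0 -lt0n.
have pair l : U * \sum_(0 <= j < m) mode 1 j * mode l j +
    D * \sum_(0 <= j < m) mode m.-1 j * mode l j = 0.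
  rewrite !mulr_sumr -big_split big_nat big1 //= => j jm.
  by rewrite !mulrA -mulrDl UD // mul0r.
have ndv a : (0 < a < m)%N -> (m %| a)%N = false.
  by move=> /andP[a0 am]; apply/negbTE/negP => /(dvdn_leq a0); lia.
have e1 : (m %| 1 + m.-1)%N by rewrite add1n prednK.
have e2 : (m %| m.-1 + m.-1)%N = false.
  have -> : (m.-1 + m.-1 = m + (m - 2))%N by lia.
  by rewrite dvdn_addr // ndv //; lia.
have e3 : (m %| 1 + 1)%N = false by rewrite ndv //; lia.
have := pair m.-1; have := pair 1%N; rewrite !sum_modeM e1 e2 e3.
rewrite [(m.-1 + 1)%N]addnC e1 !muln0 !muln1 !mulr0 addr0 add0r.
by split; apply: (mulIf m0); rewrite mul0r.
Qed.

(** The total intensity, equal to [(m + 1) (m + 5) / 12]. *)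
Lemma gcenter_pos : 0 < m%:R + gcenter.
Proof. by rewrite /gcenter; have := m_real_ge3; nra. Qed.

Lemma cvec_special_free (al0 al1 al2 be0 be1 be2 : R) : n = m.+1 ->
  (forall i, vec 1 (al1%:C + al2%:C * ci + nu%:C * (be1%:C * ci - be2%:C))
    (al0%:C + be0%:C * (nu%:C * ci) - gcenter%:C * (be1%:C * ci + be2%:C))
    (al0%:C + be0%:C * (nu%:C * ci) + (m%:R)%:C * (be1%:C * ci + be2%:C)) i
    = 0) ->
  [/\ al0 = 0 /\ be0 = 0, al1 = 0 /\ be1 = 0 & al2 = 0 /\ be2 = 0].
Proof.
move=> nm; set U := (X in vec _ X); set D := (X in vec _ _ X).
set W := (X in vec _ _ _ X) => v0.
have mn : (m < n)%N by rewrite nm.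
have W0 : W = 0 by rewrite -(v0 (Ordinal mn)) vec_center.
have [U0 D0] : U = 0 /\ D = 0.
  apply: mode_pair_free => j jm; have jn : (j < n)%N by rewrite nm ltnW.
  apply: (mulfI (zeta_neq0 j.+1)); rewrite mulr0 -(v0 (Ordinal jn)).
  by rewrite vec_ext // subn1.
(* [W - D] eliminates the translation and leaves this number times the total intensity, which is
   nonzero. *)
have r0 : be2%:C + be1%:C * (1%:C * ci) = 0.
  apply: (mulIf (_ : (m%:R + gcenter)%:C != 0)).
    by rewrite eq_complex /= negb_and gt_eqF // gcenter_pos.
  rewrite mul0r -[RHS](subrr D) {1}D0 -W0 rmorphD /W /D.
  by rewrite rmorph1; ring.
have [b2 b1] := real_coefs (oner_neq0 R) r0.
have [a0 b0] : al0 = 0 /\ be0 = 0.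
  apply: (real_coefs nu_neq0); rewrite -[RHS]W0 /W b1 b2; ring.
have [a1 a2] : al1 = 0 /\ al2 = 0.
  apply: (real_coefs (oner_neq0 R)); rewrite -[RHS]U0 /U b1 b2 rmorph1; ring.
by [].
Qed.

Lemma hart_mode_orth l c d : (1 < l < m.-1)%N ->
  \sum_(0 <= j < m) (c * mode 1 j + d * mode m.-1 j) * hart l j = 0.
Proof.
move=> lm; have [h1 _] := hart_side lm.
rewrite -subn1 sum_mode_hart //; last lia.
have /negbTE-> : (1 + l != m)%N by lia.
have /negbTE-> : (1 != l)%N by lia.
by rewrite !mul0r addr0 mulr0.
Qed.

Lemma block_bases_center : n = m.+1 -> block_bases.
Proof.
move=> nm.
have m1 : (1 < m)%N by lia.
have mp : (m.-1 < m)%N by lia.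
apply: (@stable_of_blocks m (fun k => cvec k) (fun k => cfreq k)).
- by rewrite nm.
- move=> k; case: (cvec_case (ltn_ord k)) => [->|->|->|kc].
  + by apply: vec_Bperp; lia.
  + by apply: vec_Bperp; lia.
  + rewrite /cvec eqxx (_ : (m.-1 == 0%N) = false); last lia.
    rewrite (_ : (m.-1 == 1%N) = false); last lia.
    by apply: vec_Bperp; lia.
  + by rewrite cvec_hart //; apply: vec_Bperp; lia.
- move=> k; case: (cvec_case (ltn_ord k)) => [->|->|->|kc].
  + by rewrite lin_op_cvec0; apply: vec_Bperp; lia.
  + by rewrite lin_op_cvec1; apply: vec_Bperp; lia.
  + by rewrite lin_op_cvecm; apply: vec_Bperp; lia.
  + have [h1 h2] := hart_side kc.
    by rewrite cvec_hart // lin_op_hart //; apply: vec_Bperp; lia.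
- by move=> k; exact: cfreq_neq0.
- by move=> k; exact: SS_cvec.
move=> al be e.
pose o0 := Ordinal m_gt0; pose o1 := Ordinal m1; pose o2 := Ordinal mp.
pose P (k : 'I_m) := (1 < k < m.-1)%N.
have split3 (F : 'I_m -> R[i]) :
    \sum_(k < m) F k = \sum_(k | P k) F k + (F o0 + F o1 + F o2).
  rewrite (bigD1 o0) //= (bigD1 o1) //= (bigD1 o2) /=; last first.
    by rewrite -!val_eqE /=; lia.
  rewrite (eq_bigl P); last first.
    by move=> k; rewrite -!val_eqE /= /P; have := ltn_ord k; lia.
  by rewrite !addrA addrC -!addrA.
have e_at i : \sum_(k | P k) ((al k)%:C * cvec k i + (be k)%:C * T (cvec k) i) +
    vec 1 ((al o1)%:C + (al o2)%:C * ci +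
       nu%:C * ((be o1)%:C * ci - (be o2)%:C))
    ((al o0)%:C + (be o0)%:C * (nu%:C * ci) -
       gcenter%:C * ((be o1)%:C * ci + (be o2)%:C))
    ((al o0)%:C + (be o0)%:C * (nu%:C * ci) +
       (m%:R)%:C * ((be o1)%:C * ci + (be o2)%:C)) i = 0.
  by rewrite -cvec_special -[RHS](e i) split3.
(* The frequencies strictly between [1] and [m - 1] come first: the three special vectors are
   orthogonal to them on the exterior vortices and form the remainder [r]. *)
have coefP k : P k -> al k = 0 /\ be k = 0.
  move=> Pk; have [h1 _] := hart_side Pk.
  apply: (real_coefs (mu_neq0 h1)).
  pose lam (k : 'I_m) : R[i] := (al k)%:C + (be k)%:C * ((mu k)%:C * ci).
  set U := (X in vec _ X) in e_at; set D := (X in vec _ _ X) in e_at.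
  apply: (@hart_coef _ P (fun k : 'I_m => k) lam
    (fun j => U * mode 1 j + D * mode m.-1 j)) => //.
  - by move=> i /hart_side[].
  - by move=> i l _ _ /val_inj.
  - move=> j jm; have jn : (j < n)%N by rewrite nm ltnW.
    apply: (mulfI (zeta_neq0 j.+1)); rewrite mulr0 mulrDr mulr_sumr.
    rewrite -[RHS](e_at (Ordinal jn)) vec_ext // subn1; congr (_ + _).
    apply: eq_bigr => l Pl; have [h2 h3] := hart_side Pl.
    by rewrite cvec_hart // hartvec_coef.
  exact: hart_mode_orth.
(* Once those waves are gone, only the special vectors remain. *)
have [h0 h1 h2] : [/\ al o0 = 0 /\ be o0 = 0, al o1 = 0 /\ be o1 = 0
    & al o2 = 0 /\ be o2 = 0].
  apply: cvec_special_free => // i; rewrite -[RHS](e_at i) big1 ?add0r // => k.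
  by move=> /coefP[-> ->]; rewrite !mul0r addr0.
move=> k; case: (cvec_case (ltn_ord k)) => kE; last exact: coefP.
- by rewrite (_ : k = o0) //; exact/val_inj.
- by rewrite (_ : k = o1) //; exact/val_inj.
by rewrite (_ : k = o2) //; exact/val_inj.
Qed.

(** * Total interaction and both hypotheses for the polygon *)

Lemma sum_gam_neq0 :
  \sum_(i < n) \sum_(j < n | j != i) gcfg i * gcfg j != 0.
Proof.
(* The exterior pairs give [m (m - 1)] and those with the center [2 m gcenter], which add up to
   [s]. *)
pose s := m%:R * (m%:R - 1) * (m%:R + 1) / 6 : R.
suff -> : \sum_(i < n) \sum_(j < n | j != i) gcfg i * gcfg j = s.
  rewrite /s gt_eqF // divr_gt0 // !mulr_gt0 //; have := m_real_ge3; lra.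
apply: (@complexI R); rewrite rmorph_sum /=.
transitivity (\sum_(i < n) (gam_ i)%:C *
    (if (i < m)%N then m%:R - 1 + gcenter%:C else m%:R)).
  apply: eq_bigr => i _; rewrite -mulr_sumr rmorphM rmorph_sum; congr (_ * _).
  transitivity (\sum_(j < n | j != i) (gam_ j)%:C * 1).
    by apply: eq_bigr => j _; rewrite mulr1.
  rewrite (weighted_sum (fun=> 1)); have [im|im] := ord_case i.
    rewrite im (ltn_eqF im) mulr1; congr (_ + _).
    have -> : (m%:R : R[i]) = \sum_(0 <= j < m) 1.
      by rewrite sumr_const_nat subn0.
    rewrite [in RHS](bigD1_seq (nat_of_ord i)) ?mem_index_iota ?iota_uniq //=.
    by rewrite [1 + _]addrC addrK.
  by rewrite im eqxx addr0 ltnn sum_over_center sumr_const_nat subn0.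
rewrite (sum_all (fun i => if (i < m)%N then m%:R - 1 + gcenter%:C else m%:R)).
rewrite ltnn (eq_big_nat _ _ (F2 := fun=> m%:R - 1 + gcenter%:C)); last first.
  by move=> i /andP[_ ->].
rewrite sumr_const_nat subn0 -[_ *+ m]mulr_natl gcenterC.
have -> : s%:C = m%:R * (m%:R - 1) * (m%:R + 1) / 6 :> R[i].
  rewrite /s rmorphM fmorphV !rmorphM rmorphB rmorphD rmorph1.
  by rewrite !rmorph_nat.
by field.
Qed.

Lemma polygon_stable :
  linearly_stable_releq gcfg (fun i => plane_of_complex (zcfg i)).
Proof.
split; first exact: sum_gam_neq0.
exists nu; split.
  rewrite (gradient_cfg gcfg zcfg_inj) Gammamx_cfg cfgZ cfgD -cfg0.
  apply: eq_cfg => i; rewrite zcfg_releq /nu rmorphN; ring.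
have [nm|nm] : n = m \/ n = m.+1 by lia.
  exact: block_bases_no_center.
exact: block_bases_center.
Qed.

Lemma polygon_zero_strain :
  zero_strain gcfg (fun i => plane_of_complex (zcfg i)).
Proof. exact: (zero_strain_releq zcfg_inj zcfg_releq zcfg_strain). Qed.
End Polygon.

(** * Primitive roots on the unit circle and the given configuration *)

Lemma expi_pow (R : realType) (a : R) k : expi a ^+ k = expi (a * k%:R).
Proof.
elim: k => [|k IHk]; first by rewrite mulr0 expi0.
by rewrite exprS IHk -expiD -natr1 mulrDr mulr1 addrC.
Qed.

(** The real part is [1 - 2 sin(a)^2], and the sine is positive on the open interval from 0 to [pi];
    hence the half-angle. *)
Lemma expi_neq1 (R : realType) (a : R) : 0 < a < pi -> expi (a + a) != 1.
Proof.
move=> a_itv; have sa := sin_gt0_pi a_itv.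
apply/eqP => /(congr1 (@complex.Re R)).
rewrite expiD /= => e; have := cos2Dsin2 a.
by nra.
Qed.

Lemma expi_prim (R : realType) m : (0 < m)%N ->
  m.-primitive_root (expi (2 * pi / m%:R) : R[i]).
Proof.
move=> m0; have mR : (m%:R : R) != 0 by rewrite pnatr_eq0 -lt0n.
have expi2pi : expi (pi + pi : R) = 1.
  by rewrite expiD /expi cospi sinpi; apply: complex_ext; rewrite /=; ring.
rewrite /primitive_root_of_unity m0; apply/forallP => i; rewrite unity_rootE.
rewrite expi_pow; apply/eqP; have [->|im] := eqVneq i.+1 m.
  by rewrite divfK // mulr_natl mulr2n expi2pi eqxx.
apply/negbTE; set a : R := pi * i.+1%:R / m%:R.
have -> : 2 * pi / m%:R * i.+1%:R = a + a by rewrite /a; field.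
apply: expi_neq1; rewrite /a.
have m0' : 0 < (m%:R : R) by rewrite ltr0n.
rewrite divr_gt0 ?mulr_gt0 ?pi_gt0 ?ltr0n //= ltr_pdivrMr //.
by rewrite ltr_pM2l ?pi_gt0 // ltr_nat ltn_neqAle im ltn_ord.
Qed.

Theorem theorem3p5 (R : realType) (N : nat) (hN : (4 <= N)%N) :
  zero_strain (@intensity R N) (@vortex R N) /\
  linearly_stable_releq (@intensity R N) (@vortex R N).
Proof.
pose m := N.-1; pose n := nvort N.
have m3 : (3 <= m)%N by rewrite /m; lia.
have n_range : (m <= n <= m.+1)%N by rewrite /n /m /nvort; case: ifP; lia.
have mR : (m%:R : R) = N%:R - 1 by rewrite /m -subn1 natrB //; lia.
pose zeta : R[i] := expi (2 * pi / m%:R).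
have prim : m.-primitive_root zeta by apply: expi_prim; lia.
have zu : zeta^~ * zeta = 1 by exact: expi_conjM.
(* [n = m] occurs only for [N = 6], where [m = 5] is a root of [gcenter]. *)
have g0 : n = m -> @gcenter R m = 0.
  rewrite /n /m /nvort /gcenter; case: ifP => [/eqP -> _|]; last lia.
  by rewrite subrr mulr0 mul0r.
(* With the center present [m] differs from both roots 1 and 5 of [gcenter]. *)
have gN0 : n = m.+1 -> @gcenter R m != 0.
  rewrite /n /m /nvort /gcenter; case: ifP => N6; first lia.
  move=> _; rewrite !mulf_neq0 ?invr_eq0 ?pnatr_eq0 //.
    by rewrite subr_eq0 (eqr_nat _ _ 1); lia.
  by rewrite subr_eq0 (eqr_nat _ _ 5); lia.
have iE : @intensity R N = @gcfg R m n.
  apply/funext => i; rewrite /intensity /gcfg /gam_ /gcenter mR.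
  rewrite (_ : (i.+1 < N)%N = (i < m)%N); last by rewrite /m; lia.
  by case: ifP => // _; field.
have vE : @vortex R N = fun i => plane_of_complex (@zcfg R m n zeta i).
  apply/funext => i; rewrite /vortex /zcfg /pos_ /zeta mR.
  rewrite (_ : (i.+1 < N)%N = (i < m)%N); last by rewrite /m; lia.
  by case: ifP => // _; rewrite -[LHS]toCK toC0.
rewrite iE vE; split.
  exact: polygon_zero_strain.
exact: polygon_stable.
Qed.
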